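(* Let $n>1$ and let $\psi: Sp_{2n}\to M_{n,n+1}$ be the map sending $g\in Sp_{2n}$ to its principal (upper-left) $n\times(n+1)$ submatrix, with induced homomorphism $\psi^*:\mathcal{O}(M_{n,n+1})\to\mathcal{O}(Sp_{2n})$, $\psi^*(f)=f\circ\psi$. Then $\psi^*$ restricts to a map $\psi^*:\mathcal{B}'\to\mathcal{B}$, and this map is an isomorphism of $\Lambda_{n-1,n}$-graded $SL_2$-algebras (that is, an algebra isomorphism which intertwines the $SL_2$-actions and maps the $(\mu,\lambda)$-graded component $V^{\lambda^+/\mu}$ of $\mathcal{B}'$ onto the $(\mu,\lambda)$-graded component $W^{\lambda/\mu}$ of $\mathcal{B}$ for all $(\mu,\lambda)\in\Lambda_{n-1,n}$).
   Context: All varieties and groups are over $\mathbb{C}$; $\mathcal{O}(X)$ denotes the regular functions on $X$. $\Lambda_k$ is the semigroup of weakly decreasing sequences of $k$ non-negative integers, and $\Lambda_{m,k}=\Lambda_m\times\Lambda_k$. For $\lambda\in\Lambda_n$, $\lambda^+\in\Lambda_{n+1}$ is $\lambda$ with a zero appended. For $t=\mathrm{diag}(t_1,\dots,t_k)$ and $\lambda \in \Lambda_k$, $t^\lambda=\prod_i t_i^{\lambda_i}$. General linear side. $T_k,U_k,\overline{U}_k\subset GL_k$ are the diagonal, upper-triangular unipotent and lower-triangular unipotent matrices. $GL_{n-1}\subset GL_{n+1}$ is embedded as the upper-left block (with $I_2$ in the lower-right block), and $SL_2\subset GL_{n+1}$ is embedded as the lower-right $2\times2$ block (with $I_{n-1}$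 in the upper-left block). $M_{n,n+1}$ is the space of $n\times(n+1)$ complex matrices. Define $$\mathcal{B}'=\mathcal{O}(\overline{U}_n\backslash M_{n,n+1}/U_{n-1})=\{f\in\mathcal{O}(M_{n,n+1}): f(\overline{u}xu)=f(x)\ \forall\,\overline{u}\in\overline{U}_n,\ u\in U_{n-1}\}.$$ It is graded by $\Lambda_{n-1,n}$; the $(\mu,\lambda)$-component, denoted $V^{\lambda^+/\mu}$, is the set of $f\in\mathcal{B}'$ with $f(txs)=t^\lambda s^\mu f(x)$ for $t\in T_n$, $s\in T_{n-1}\subset GL_{n-1}\subset GL_{n+1}$. It is identified with the space of $U_{n-1}$-invariant vectors of $T_{n-1}$-weight $\mu$ in the irreducible $GL_{n+1}$-module of highest weight $\lambda^+$. $SL_2$ acts on $\mathcal{B}'$ by right translation. Symplectic side. Let $s_n$ be the $n\times n$ matrix with ones on the antidiagonal and zeros elsewhere, $J_n=\begin{bmatrix}0&s_n\\-s_n&0\end{bmatrix}$, and $Sp_{2n}=\{g\in GL_{2n}: g^tJ_ng=J_n\}$. Label the standard basis of $\mathbb{C}^{2n}$ as $e_{\pm1},\dots,e_{\pm n}$ with $e_{-i}=e_{2n+1-i}$. Set $T_{C_n}=T_{2n}\cap Sp_{2n}$, $U_{C_n}=U_{2n}\cap Sp_{2n}$, $\overline{U}_{C_n}=\overline{U}_{2n}\cap Sp_{2n}$. Embed $Sp_{2n-2}\subset Sp_{2n}$ as the subgroup fixing $e_{n}$ and $e_{-n}$, and let $U_{C_{n-1}}=U_{2n}\cap Sp_{2n-2}$,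 $T_{C_{n-1}}=T_{2n}\cap Sp_{2n-2}$. Embed $SL_2=Sp_2\subset Sp_{2n}$ as $\{g\in Sp_{2n}: ge_{\pm i}=e_{\pm i},\ i=1,\dots,n-1\}$; it commutes with $Sp_{2n-2}$. Define $$\mathcal{B}=\mathcal{O}(\overline{U}_{C_n}\backslash Sp_{2n}/U_{C_{n-1}})=\{f\in\mathcal{O}(Sp_{2n}): f(\overline{u}gu)=f(g)\ \forall\,\overline{u}\in\overline{U}_{C_n},\,u\in U_{C_{n-1}}\}.$$ It is graded by $\Lambda_{n-1,n}$: the $(\mu,\lambda)$-component $W^{\lambda/\mu}$ is the set of $f\in\mathcal{B}$ with $f(tgs)=t^\lambda s^\mu f(g)$ for $t\in T_{C_n}$, $s\in T_{C_{n-1}}$ (where $t^\lambda=\prod_{i\le n} t_i^{\lambda_i}$ for $t=\mathrm{diag}(t_1,\dots,t_n,t_n^{-1},\dots,t_1^{-1})$, and similarly for $s$). $SL_2$ acts on $\mathcal{B}$ by right translation. *)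

(* Defs.v *)
From HB Require Import structures.
From mathcomp Require Import all_boot all_order all_algebra.
From mathcomp Require Import boolp classical_sets functions.
From mathcomp Require Import reals complex mpoly.
From mathcomp Require Import ring zify.

Set Implicit Arguments.
Unset Strict Implicit.
Unset Printing Implicit Defensive.

Import GRing.Theory.
Local Open Scope ring_scope.

(* An alias for X -> C carrying its pointwise C-algebra structure: the module  *)
(* structure available in the library is on X -> C^o.  X is pointed because    *)
(* algebras are required to be nonzero.                                        *)
Definition fct (X : Type) (C : Type) : Type := X -> C.

Section FunctionAlgebra.
Variables (X : pointedType) (C : comNzRingType).

HB.instance Definition _ := GRing.ComNzRing.copy (fct X C) (X -> C).
HB.instance Definition _ := GRing.Lmodule.copy (fct X C) (X -> C^o).

Fact fct_scalerAl (a : C) (f g : fct X C) : a *: (f * g) = (a *: f) * g.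
Proof. by apply/funext => x; apply: mulrA. Qed.

HB.instance Definition _ :=
  GRing.Lmodule_isLalgebra.Build C (fct X C) fct_scalerAl.
HB.instance Definition _ := GRing.Lalgebra_isComAlgebra.Build C (fct X C).

End FunctionAlgebra.

(* Regular functions on a Zariski-closed subset X of an affine space of        *)
(* matrices, with inclusion [emb]: the restrictions of the polynomials in the  *)
(* matrix entries.  For the symplectic group, which is closed in the space of  *)
(* all matrices, no inverse of the determinant is needed.                      *)
Definition regular_function (C : comNzRingType) (X : Type) (p q : nat)
    (emb : X -> 'M[C]_(p, q)) (f : fct X C) : Prop :=
  exists P : {mpoly C[p * q]},
    forall x, f x = P.@[fun k => mxvec (emb x) 0 k].

Section RegularFunctions.
Variables (C : comNzRingType) (X : pointedType) (p q : nat).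
Variable emb : X -> 'M[C]_(p, q).

Lemma regular_function1 : regular_function emb (1 : fct X C).
Proof. by exists 1 => x; rewrite meval1. Qed.

Lemma regular_functionZD (a : C) (f g : fct X C) :
  regular_function emb f -> regular_function emb g ->
  regular_function emb (a *: f + g).
Proof.
by move=> [P fP] [Q gQ]; exists (a *: P + Q) => x; rewrite mevalD mevalZ -fP -gQ.
Qed.

Lemma regular_functionM (f g : fct X C) :
  regular_function emb f -> regular_function emb g ->
  regular_function emb (f * g).
Proof.
by move=> [P fP] [Q gQ]; exists (P * Q) => x; rewrite mevalM -fP -gQ.
Qed.

Lemma regular_function_mulmxr (h : 'M[C]_q) (r : X -> X) (f : fct X C) :
  (forall x, emb (r x) = emb x *m h) ->
  regular_function emb f -> regular_function emb (f \o r).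
Proof.
move=> rE [P fP].
pose L : 'M[C]_(p * q) := lin_mulmxr h.
exists (P \mPo [tuple \sum_i L i k *: 'X_i | k < p * q]) => x /=.
rewrite fP comp_mpoly_meval; apply: meval_eq => k.
rewrite tnth_mktuple rE -[emb x *m h]/(mulmxr h (emb x)) -mul_vec_lin mxE.
rewrite raddf_sum.
by apply: eq_bigr => i _ /=; rewrite mevalZ mevalXU mulrC.
Qed.

End RegularFunctions.

(* [dominant k] is the semigroup of weakly decreasing sequences of k           *)
(* non-negative integers.                                                      *)
Definition dominant (k : nat) := {l : k.-tuple nat | sorted geq l}.

Definition weight (C : comNzRingType) (k : nat) (d : 'I_k -> C)
    (l : dominant k) : C :=
  \prod_(i < k) d i ^+ tnth (val l) i.

Section Matrices.
Variable C : fieldType.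

Definition lower_unip (k : nat) (A : 'M[C]_k) : bool :=
  is_trig_mx A && [forall i, A i i == 1].

Definition upper_unip (k : nat) (A : 'M[C]_k) : bool := lower_unip A^T.

Definition torus (k : nat) (A : 'M[C]_k) : bool :=
  is_diag_mx A && (A \in unitmx).

(* The N x N matrix with A as diagonal block in rows and columns               *)
(* o, ..., o + k - 1, and equal to the identity elsewhere.                     *)
Definition diag_block (k N o : nat) (A : 'M[C]_k) : 'M[C]_N :=
  \matrix_(i, j)
    match [pick a : 'I_k | (o + a == i)%N],
          [pick b : 'I_k | (o + b == j)%N] with
    | Some a, Some b => A a b
    | _, _ => (i == j)%:R
    end.

Definition block_incl (k N o : nat) : 'M[C]_(N, k) :=
  \matrix_(i, a) (o + a == i)%N%:R.

Lemma pick_block (k o i : nat) :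
  (exists2 a : 'I_k, (o + a = i)%N & [pick b : 'I_k | (o + b == i)%N] = Some a)
  \/ (forall a : 'I_k, (o + a == i)%N = false) /\
     [pick b : 'I_k | (o + b == i)%N] = None.
Proof.
case: pickP => [a /eqP Ha|H]; [by left; exists a | by right].
Qed.

Lemma diag_blockE (k N o : nat) (A : 'M[C]_k) :
  diag_block N o A =
  1%:M + block_incl k N o *m (A - 1%:M) *m (block_incl k N o)^T.
Proof.
apply/matrixP => i j; rewrite !mxE.
have sumE (F : 'I_k -> C) (l : nat) : \sum_b F b * (o + b == l)%N%:R =
    if [pick b : 'I_k | (o + b == l)%N] is Some b then F b else 0.
  case: (pick_block k o l) => [[b <- ->]|[H ->]].
    rewrite (bigD1 b) //= eqxx mulr1 big1 ?addr0 // => c /negPf cb.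
    by rewrite eqn_add2l (_ : (c == b :> nat) = false) ?mulr0.
  by rewrite big1 // => b _; rewrite H mulr0.
under eq_bigr => b _.
  rewrite !mxE.
  under eq_bigr => a _ do rewrite !mxE mulrC.
  rewrite (sumE (fun a => A a b - (a == b)%:R)).
  over.
rewrite (sumE (fun b => if [pick a : 'I_k | (o + a == i)%N] is Some a
                        then A a b - (a == b)%:R else 0)).
case: (pick_block k o i) => [[a ai ->]|[H ->]];
  case: (pick_block k o j) => [[b bj ->]|[H' ->]]; rewrite ?addr0 //.
rewrite (_ : (i == j) = (a == b)) ?subrKC ?addrC ?subrK //.
by rewrite -val_eqE /= -ai -bj eqn_add2l.
Qed.

Lemma block_inclTK (k N o : nat) : (o + k <= N)%N ->
  (block_incl k N o)^T *m block_incl k N o = 1%:M.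
Proof.
move=> le_ok; apply/matrixP => a b; rewrite !mxE.
have ltN (c : 'I_k) : (o + c < N)%N.
  by apply: leq_trans le_ok; rewrite ltn_add2l.
rewrite (bigD1 (Ordinal (ltN a))) //= !mxE /= eqxx mul1r eqn_add2l eq_sym.
rewrite big1 ?addr0 // => i ia; rewrite !mxE.
case: eqP => [ai|]; last by rewrite mul0r.
by case/eqP: ia; apply: val_inj.
Qed.

Lemma block_inclT0 (k k' N o o' : nat) : (o + k <= o')%N ->
  (block_incl k N o)^T *m block_incl k' N o' = 0.
Proof.
move=> le_oo; apply/matrixP => a b; rewrite !mxE big1 // => i _; rewrite !mxE.
case: eqP => [<-|]; last by rewrite mul0r.
case: eqP => [eq_ab|]; last by rewrite mulr0.
suff: (o + a < o' + b)%N by rewrite eq_ab ltnn.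
by apply: leq_trans (leq_addr _ _); apply: leq_trans le_oo; rewrite ltn_add2l.
Qed.

Lemma diag_blockC (k k' N o o' : nat) (A : 'M[C]_k) (B : 'M[C]_k') :
  (o + k <= o')%N ->
  diag_block N o A *m diag_block N o' B = diag_block N o' B *m diag_block N o A.
Proof.
move=> le_oo; rewrite !diag_blockE.
have H := block_inclT0 k' N le_oo.
have H' : (block_incl k' N o')^T *m block_incl k N o = 0.
  by rewrite -[LHS]trmxK trmx_mul trmxK H trmx0.
set P := block_incl k N o in H H' *; set Q := block_incl k' N o' in H H' *.
have XY : P *m (A - 1%:M) *m P^T *m (Q *m (B - 1%:M) *m Q^T) = 0.
  by rewrite !mulmxA -[_ *m P^T *m Q]mulmxA H mulmx0 !mul0mx.
have YX : Q *m (B - 1%:M) *m Q^T *m (P *m (A - 1%:M) *m P^T) = 0.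
  by rewrite !mulmxA -[_ *m Q^T *m P]mulmxA H' mulmx0 !mul0mx.
move: XY YX; set X := P *m _ *m _; set Y := Q *m _ *m _ => XY YX.
rewrite !mulmxDl !mulmxDr !mul1mx !mulmx1 XY YX !addr0 -!addrA.
by congr (_ + _); rewrite addrC.
Qed.

Definition antidiag (n : nat) : 'M[C]_n := \matrix_(i, j) (j == rev_ord i)%:R.

Definition Jmx (n : nat) : 'M[C]_(n + n) :=
  block_mx 0 (antidiag n) (- antidiag n) 0.

Definition symplectic (n : nat) (g : 'M[C]_(n + n)) : bool :=
  g^T *m Jmx n *m g == Jmx n.

Lemma antidiagK n : antidiag n *m antidiag n = 1%:M.
Proof.
apply/matrixP => i j; rewrite !mxE (bigD1 (rev_ord i)) //= !mxE eqxx mul1r.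
rewrite rev_ordK eq_sym big1 ?addr0 // => k /negPf ki.
by rewrite !mxE ki mul0r.
Qed.

Lemma JmxK n : Jmx n *m Jmx n = - 1%:M.
Proof.
rewrite /Jmx mulmx_block !mul0mx !mulmx0 !addr0 !add0r.
by rewrite mulNmx mulmxN antidiagK (@scalar_mx_block _ n n) opp_block_mx !oppr0.
Qed.

Lemma symplectic1 n : symplectic (1%:M : 'M[C]_(n + n)).
Proof. by rewrite /symplectic trmx1 mul1mx mulmx1. Qed.

Lemma symplecticM n (g h : 'M[C]_(n + n)) :
  symplectic g -> symplectic h -> symplectic (g *m h).
Proof.
move=> /eqP gJ /eqP hJ; apply/eqP.
by rewrite trmx_mul -!mulmxA [g^T *m _]mulmxA [_ *m (g *m h)]mulmxA gJ mulmxA hJ.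
Qed.

Lemma symplectic_unit n (g : 'M[C]_(n + n)) : symplectic g -> g \in unitmx.
Proof.
move=> /eqP gJ; have /mulmx1_unit[] // : - Jmx n *m g^T *m Jmx n *m g = 1%:M.
by rewrite -!mulmxA [g^T *m _]mulmxA gJ mulNmx JmxK opprK.
Qed.

Lemma symplecticV n (g : 'M[C]_(n + n)) : symplectic g -> symplectic (invmx g).
Proof.
move=> gS; have gU := symplectic_unit gS; apply/eqP.
rewrite -[in LHS](eqP gS) !mulmxA -trmx_mul mulmxV // trmx1 mul1mx.
by rewrite -!mulmxA mulmxV // mulmx1.
Qed.

End Matrices.

Arguments Jmx {C} n.
Arguments diag_block {C k} N o A.
Arguments torus {C k} A.
Arguments lower_unip {C k} A.
Arguments upper_unip {C k} A.

Definition Sp (C : fieldType) (n : nat) :=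
  {g : 'M[C]_(n + n) | symplectic g}.

Section SymplecticGroup.
Variables (C : fieldType) (n : nat).
Implicit Types g h : Sp C n.

HB.instance Definition _ := SubChoice.on (Sp C n).

Definition Sp_one : Sp C n := Sub 1%:M (symplectic1 C n).
Definition Sp_mul g h : Sp C n :=
  Sub (val g *m val h) (symplecticM (valP g) (valP h)).
Definition Sp_inv g : Sp C n := Sub (invmx (val g)) (symplecticV (valP g)).

Fact Sp_mulA : associative Sp_mul.
Proof. by move=> g h k; apply: val_inj; rewrite /= mulmxA. Qed.
Fact Sp_mul1g : left_id Sp_one Sp_mul.
Proof. by move=> g; apply: val_inj; rewrite /= mul1mx. Qed.
Fact Sp_mulg1 : right_id Sp_one Sp_mul.
Proof. by move=> g; apply: val_inj; rewrite /= mulmx1. Qed.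
Fact Sp_mulVg : left_inverse Sp_one Sp_inv Sp_mul.
Proof.
by move=> g; apply: val_inj; rewrite /= mulVmx // symplectic_unit ?(valP g).
Qed.
Fact Sp_mulgV : right_inverse Sp_one Sp_inv Sp_mul.
Proof.
by move=> g; apply: val_inj; rewrite /= mulmxV // symplectic_unit ?(valP g).
Qed.

HB.instance Definition _ :=
  isGroup.Build (Sp C n) Sp_mulA Sp_mul1g Sp_mulg1 Sp_mulVg Sp_mulgV.
HB.instance Definition _ := isPointed.Build (Sp C n) (1%g : Sp C n).

(* The basis vectors e_(i+1) and e_-(i+1) (ordinals are 0-based).              *)
Definition e_pos (i : 'I_n) : 'cV[C]_(n + n) := delta_mx (lshift n i) 0.
Definition e_neg (i : 'I_n) : 'cV[C]_(n + n) := delta_mx (rev_ord (lshift n i)) 0.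

Definition fixes_pair (g : Sp C n) (i : 'I_n) : bool :=
  (val g *m e_pos i == e_pos i) && (val g *m e_neg i == e_neg i).

(* Sp_(2n-2), the subgroup fixing e_n and e_-n. *)
Definition Sp_pred (g : Sp C n) : bool :=
  [forall i : 'I_n, (i == n.-1 :> nat) ==> fixes_pair g i].

(* The subgroups \bar U_(C_n), T_(C_n), U_(C_(n-1)), T_(C_(n-1)).              *)
Definition Ubar_C : {pred Sp C n} := fun g => lower_unip (val g).
Definition T_C : {pred Sp C n} := fun g => torus (val g).
Definition U_C_pred : {pred Sp C n} := fun g => Sp_pred g && upper_unip (val g).
Definition T_C_pred : {pred Sp C n} := fun g => Sp_pred g && torus (val g).

End SymplecticGroup.

Definition SL2 (C : fieldType) := {h : 'M[C]_2 | \det h == 1}.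

Section SL2Embeddings.
Variables (C : fieldType) (n : nat).

Let P : 'M[C]_(n + n, 2) := block_incl C 2 (n + n) n.-1.

Lemma JmxE (k : nat) (i j : 'I_(k + k)) :
  Jmx k i j =
  (if (i < k)%N then 1 else -1) * (i + j == (k + k).-1)%N%:R :> C.
Proof.
rewrite /Jmx; case: (split_ordP i) => i' ->; case: (split_ordP j) => j' ->;
  rewrite ?block_mxEul ?block_mxEur ?block_mxEdl ?block_mxEdr !mxE;
  rewrite -?val_eqE /= ?ltn_ord ?[(k + _ < k)%N]ltnNge ?leq_addr ?mul1r ?mulN1r;
  have := ltn_ord i'; have := ltn_ord j' => jk ik.
- by rewrite (_ : (_ + _ == _)%N = false) //; apply/negbTE; lia.
- by congr (_ %:R); lia.
- by congr (- _ %:R); lia.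
- by rewrite (_ : (_ + _ == _)%N = false) ?oppr0 //; apply/negbTE; lia.
Qed.

Lemma Jmx_block_incl : Jmx n *m P = P *m Jmx 1.
Proof.
rewrite /P; case: n => [|m]; first by apply/matrixP => -[].
apply/matrixP => i a; rewrite !mxE.
have ri : (rev_ord i + i = (m.+1 + m.+1).-1)%N by have /= := ltn_ord i; lia.
rewrite (bigD1 (rev_ord i)) //= big1 => [|j ji]; last first.
  rewrite JmxE (_ : (_ + _ == _)%N = false) ?mulr0 ?mul0r //.
  apply: contraNF ji => /eqP ij; apply/eqP/val_inj => /=.
  by have := ltn_ord i; lia.
rewrite addr0 JmxE addnC ri eqxx mulr1 mxE big_ord_recl big_ord1.
rewrite !(@JmxE 1) !mxE /= /bump /=; have := ltn_ord i.
case: a => -[|[|//]] /= _ im; rewrite ?(mulr0, mulr1, addr0, add0r, mulrN1);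
  rewrite ?addn0 ?addn1.
- by case: ltnP => ?; case: eqP => ?; case: eqP => ?;
    rewrite ?mulr1 ?mulr0 ?oppr0 //; exfalso; lia.
- by case: ltnP => ?; case: eqP => ?; case: eqP => ?;
    rewrite ?mulr1 ?mulr0 ?oppr0 //; exfalso; lia.
Qed.

Lemma trmx_Jmx k : (Jmx k)^T = - Jmx k :> 'M[C]_(k + k).
Proof.
have asym : (antidiag C k)^T = antidiag C k.
  apply/matrixP => i j; rewrite !mxE; congr (_ %:R).
  by rewrite -(inj_eq rev_ord_inj) rev_ordK eq_sym.
by rewrite /Jmx tr_block_mx !trmx0 linearN /= asym opp_block_mx !oppr0 opprK.
Qed.

Lemma block_incl_Jmx : P^T *m Jmx n = Jmx 1 *m P^T.
Proof.
have := congr1 trmx Jmx_block_incl.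
by rewrite !trmx_mul (trmx_Jmx n) (trmx_Jmx 1) mulmxN mulNmx => /oppr_inj.
Qed.

Lemma det2_Jmx (h : 'M[C]_2) : h^T *m Jmx 1 *m h = \det h *: (Jmx 1 : 'M_2).
Proof.
have dE : \det h = h 0 0 * h 1 1 - h 0 1 * h 1 0.
  rewrite (expand_det_row _ 0) !big_ord_recl big_ord0 /cofactor !det_mx11 !mxE /=.
  rewrite addr0 mul1r mulN1r mulrN.
  by congr (_ * h _ _ - h _ _ * h _ _); apply: val_inj.
have JE : (Jmx 1 : 'M_2) =
    \matrix_(i, j) ((if (i < 1)%N then 1 else -1) * (i + j == 1)%N%:R) :> 'M[C]_2.
  by apply/matrixP => i j; rewrite (@JmxE 1) mxE.
transitivity (h^T *m (Jmx 1 : 'M_2) *m h) => //; rewrite JE.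
apply/matrixP => i j; rewrite dE !mxE !big_ord_recl !big_ord0 !mxE.
rewrite !big_ord_recl !big_ord0 !mxE /=.
rewrite (_ : lift ord0 ord0 = 1); last exact: val_inj.
rewrite -![ord0]/(0 : 'I_2).
have [->|->] : i = 0 \/ i = 1.
  by case: i => -[|[|//]] ?; [left | right]; apply: val_inj.
all: have [->|->] : j = 0 \/ j = 1.
all: try by case: j => -[|[|//]] ?; [left | right]; apply: val_inj.
all: rewrite /=; ring.
Qed.

Lemma symplectic_diag_block (h : 'M[C]_2) :
  \det h = 1 -> symplectic (diag_block (n + n) n.-1 h).
Proof.
case: (posnP n) => [->|n_gt0] h1; first by apply/eqP/matrixP => -[].
have PK : P^T *m P = 1%:M by apply: block_inclTK; lia.
have hJ : h^T *m Jmx 1 *m h = Jmx 1 by rewrite det2_Jmx h1 scale1r.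
apply/eqP; rewrite diag_blockE -/P.
set X := h - 1%:M.
have -> : (1%:M + P *m X *m P^T)^T = 1%:M + P *m X^T *m P^T.
  by rewrite [LHS]raddfD /= trmx1 !trmx_mul trmxK mulmxA.
have E1 : P *m X^T *m P^T *m Jmx n = P *m (X^T *m Jmx 1) *m P^T.
  by rewrite -!mulmxA block_incl_Jmx.
have E2 : Jmx n *m (P *m X *m P^T) = P *m (Jmx 1 *m X) *m P^T.
  by rewrite !mulmxA Jmx_block_incl.
have E3 : P *m (X^T *m Jmx 1) *m P^T *m (P *m X *m P^T) =
          P *m (X^T *m Jmx 1 *m X) *m P^T.
  by rewrite !mulmxA -[_ *m P^T *m P]mulmxA PK mulmx1.
rewrite mulmxDl mul1mx E1 mulmxDr mulmx1 mulmxDl E2 E3 -addrA.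
rewrite -[RHS]addr0; congr (_ + _).
rewrite -!mulmxDl -!mulmxDr.
suff -> : X^T *m Jmx 1 + (Jmx 1 *m X + X^T *m Jmx 1 *m X) = 0.
  by rewrite mulmx0 mul0mx.
have hE : h = 1%:M + X by rewrite subrKC.
apply: (addrI (Jmx 1)); rewrite addr0 -[RHS]hJ hE.
clearbody X; rewrite [(1%:M + X)^T]raddfD /= trmx1 mulmxDl mul1mx !mulmxDr !mulmx1 mulmxDl.
by rewrite !addrA.
Qed.

(* SL_2 in GL_(n+1), as the lower-right 2 x 2 block.                           *)
Definition SL2_GL (h : SL2 C) : 'M[C]_n.+1 := diag_block n.+1 n.-1 (val h).

(* SL_2 in Sp_2n, acting on the plane (e_n, e_-n); see [SL2_SpP].              *)
Definition SL2_Sp (h : SL2 C) : Sp C n :=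
  Sub (diag_block (n + n) n.-1 (val h)) (symplectic_diag_block (eqP (valP h))).

Lemma SL2_GL_comm (h : SL2 C) (u : 'M[C]_n.-1) :
  diag_block n.+1 0 u *m SL2_GL h = SL2_GL h *m diag_block n.+1 0 u.
Proof. exact: diag_blockC. Qed.

Lemma SL2_Sp_comm (h : SL2 C) (u : Sp C n) :
  Sp_pred u -> (u * SL2_Sp h)%g = (SL2_Sp h * u)%g.
Proof.
move=> uS; apply: val_inj; rewrite /= diag_blockE -/P.
case: (posnP n) => [n0|n_gt0].
  by apply/matrixP => -[i /= iN]; exfalso; move: iN; rewrite n0.
have [i0 i0E] : {i : 'I_n | i = n.-1 :> nat}.
  by have lt : (n.-1 < n)%N by [lia]; exists (Ordinal lt).
have /forallP/(_ i0)/implyP := uS; rewrite i0E eqxx => /(_ isT).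
case/andP => /eqP up /eqP un.
have uP : val u *m P = P.
  have PE (a : 'I_2) : col a P = if a == 0 then e_pos C i0 else e_neg C i0.
    apply/matrixP => i j; rewrite !mxE ord1; have iN := ltn_ord i.
    by case: a => -[|[|//]] /= ?; rewrite !mxE -!val_eqE /= i0E andbT;
      congr (nat_of_bool _)%:R; lia.
  apply/matrixP => i a; transitivity (col a (val u *m P) i 0); first by rewrite [RHS]mxE.
  have <- : col a P i 0 = P i a by rewrite [LHS]mxE.
  rewrite [in LHS]colE -mulmxA -colE PE.
  by case: ifP => _; rewrite ?up ?un.
have PJK : Jmx 1 *m Jmx 1 = - 1%:M :> 'M[C]_(1 + 1) := JmxK C 1.
have Pu : P^T *m val u = P^T.
  have : (val u)^T *m Jmx n *m val u *m P = Jmx n *m P by rewrite (eqP (valP u)).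
  rewrite -mulmxA uP -mulmxA Jmx_block_incl mulmxA.
  move/(congr1 (mulmx^~ (Jmx 1))); rewrite -!mulmxA PJK !mulmxN !mulmx1.
  by move/oppr_inj/(congr1 trmx); rewrite trmx_mul trmxK.
rewrite mulmxDl mulmxDr mul1mx mulmx1; congr (_ + _).
by rewrite -!mulmxA Pu !mulmxA uP.
Qed.

(* The image of SL_2 in Sp_2n consists of the g with g e_i = e_i and           *)
(* g e_-i = e_-i for 1 <= i <= n - 1.                                          *)
Lemma SL2_SpP (g : Sp C n) : (0 < n)%N ->
  (exists h : SL2 C, g = SL2_Sp h) <->
  (forall i : 'I_n, (i < n.-1)%N -> fixes_pair g i).
Proof.
move=> n_gt0; have PK : P^T *m P = 1%:M by apply: block_inclTK; lia.
split=> [[h ->] i lt_i|fix_g].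
  rewrite /fixes_pair /= diag_blockE -/P.
  suff H (j : 'I_(n + n)) : (j < n.-1)%N || (n < j)%N ->
      P^T *m (delta_mx j 0 : 'cV_(n + n)) = 0.
    rewrite !mulmxDl !mul1mx /e_pos /e_neg -![_ *m P^T *m _]mulmxA !H ?mulmx0.
    - by rewrite !addr0 !eqxx.
    - by rewrite /=; apply/orP; right; lia.
    - by rewrite /= lt_i.
  move=> jP; rewrite -colE; apply/matrixP => a b; rewrite !mxE.
  by case: eqP => // aj; move: jP; rewrite -aj; have := ltn_ord a; lia.
pose Q := P *m P^T.
have gQ : val g *m (1%:M - Q) = 1%:M - Q.
  apply/matrixP => i j.
  transitivity (col j (val g *m (1%:M - Q)) i 0); first by rewrite [RHS]mxE.
  transitivity (col j (1%:M - Q) i 0); last by rewrite [LHS]mxE.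
  congr (fun_of_matrix _ i 0); rewrite colE -mulmxA -colE.
  have [jP|jP] := boolP ((j < n.-1)%N || (n < j)%N).
    have -> : col j (1%:M - Q) = delta_mx j 0.
      rewrite colE mulmxBl mul1mx -mulmxA -colE.
      rewrite (_ : col j P^T = 0) ?mulmx0 ?subr0 //.
      apply/matrixP => a b; rewrite !mxE.
      by case: eqP => // aj; move: jP; rewrite -aj; have := ltn_ord a; lia.
    have jN := ltn_ord j; case/orP: jP => jP.
      have jn : (j < n)%N by lia.
      have /andP[/eqP + _] := fix_g (Ordinal jn) jP.
      by rewrite /e_pos (_ : lshift n _ = j) //; apply: val_inj.
    have jn : (n + n - j.+1 < n)%N by lia.
    have jn' : (Ordinal jn < n.-1)%N by rewrite /=; lia.
    have /andP[_ /eqP] := fix_g (Ordinal jn) jn'.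
    rewrite /e_neg (_ : rev_ord _ = j) //; apply: val_inj => /=; lia.
  have jN : (j - n.-1 < 2)%N by lia.
  have jE : delta_mx j 0 = P *m (delta_mx (Ordinal jN) 0 : 'cV_2).
    rewrite -colE; apply/matrixP => k b; rewrite !mxE ord1 eqxx andbT.
    by rewrite -val_eqE /=; congr (nat_of_bool _)%:R; lia.
  rewrite colE jE mulmxBl mul1mx [Q *m _]mulmxA -(mulmxA P) PK mulmx1 subrr.
  by rewrite mulmx0.
have JQ : Jmx n *m Q = Q *m Jmx n.
  by rewrite mulmxA Jmx_block_incl -!mulmxA block_incl_Jmx.
have gQT : (val g)^T *m (1%:M - Q) = 1%:M - Q.
  have := congr1 (mulmx^~ (1%:M - Q)) (eqP (valP g)).
  rewrite /= -!mulmxA gQ.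
  have -> : Jmx n *m (1%:M - Q) = (1%:M - Q) *m Jmx n.
    by rewrite mulmxBr mulmxBl mul1mx mulmx1 JQ.
  move/(congr1 (mulmx^~ (Jmx n))).
  by rewrite /= -!mulmxA JmxK !mulmxN !mulmx1 => /oppr_inj.
have QT : Q^T = Q by rewrite trmx_mul trmxK.
have Qg : (1%:M - Q) *m val g = 1%:M - Q.
  have := congr1 trmx gQT.
  by rewrite trmx_mul trmxK raddfB /= trmx1 QT.
have comm_Qg : Q *m val g = val g *m Q.
  have : (1%:M - Q) *m val g = val g *m (1%:M - Q) by rewrite gQ Qg.
  by rewrite mulmxBl mulmxBr mul1mx mulmx1 => /addrI/oppr_inj.
pose h := P^T *m val g *m P.
have h1 : \det h = 1.
  have hJ : h^T *m Jmx 1 *m h = Jmx 1.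
    rewrite /h !trmx_mul trmxK -!mulmxA.
    rewrite [Jmx 1 *m (P^T *m _)]mulmxA -block_incl_Jmx.
    have -> : P *m (P^T *m Jmx n *m (val g *m P)) = Jmx n *m val g *m P.
      rewrite !mulmxA -/Q -JQ -[_ *m Q *m _]mulmxA comm_Qg -!mulmxA.
      by rewrite PK mulmx1.
    rewrite [(val g)^T *m _]mulmxA [(val g)^T *m (_ *m _)]mulmxA (eqP (valP g)).
    by rewrite mulmxA block_incl_Jmx -mulmxA PK mulmx1.
  move: hJ; rewrite det2_Jmx => /matrixP/(_ 0 1).
  by rewrite mxE (@JmxE 1) /= mul1r mulr1.
have h1b : \det h == 1 by apply/eqP.
exists (exist (fun k : 'M[C]_2 => \det k == 1) h h1b).
apply: val_inj; rewrite /= diag_blockE -/P.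
rewrite mulmxBr mulmx1 mulmxBl -/Q /h.
have -> : P *m (P^T *m val g *m P) *m P^T = val g *m Q.
  by rewrite !mulmxA -/Q comm_Qg -!mulmxA [P^T *m (P *m _)]mulmxA PK mul1mx.
move: gQ; rewrite mulmxBr mulmx1 => gQ.
by rewrite -[LHS](subrK (val g *m Q)) gQ -addrA [- Q + _]addrC.
Qed.

End SL2Embeddings.

(* M_(n,n+1), pointed at 0. *)
Definition Mat (C : fieldType) (n : nat) : Type := 'M[C]_(n, n.+1).

HB.instance Definition _ (C : fieldType) (n : nat) := Choice.on (Mat C n).
HB.instance Definition _ (C : fieldType) (n : nat) :=
  isPointed.Build (Mat C n) (0 : 'M[C]_(n, n.+1)).

Section BGL.
Variables (C : fieldType) (n : nat).

(* B' = O(\bar U_n \ M_(n,n+1) / U_(n-1)).                                    *)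
Definition BGL_prop (f : fct (Mat C n) C) : Prop :=
  regular_function (fun x : Mat C n => x : 'M[C]_(n, n.+1)) f /\
  forall (ubar : 'M[C]_n) (u : 'M[C]_n.-1) (x : Mat C n),
    lower_unip ubar -> upper_unip u ->
    f (ubar *m x *m diag_block n.+1 0 u) = f x.

Definition BGL_pred : {pred fct (Mat C n) C} := fun f => `[< BGL_prop f >].

Definition BGL := {f : fct (Mat C n) C | f \in BGL_pred}.

Fact BGL_subalg : GRing.subsemialg_closed BGL_pred.
Proof.
apply: GRing.subalg_closed_semi; split.
- apply/asboolP; split=> //; exact: regular_function1.
- move=> a f g /asboolP[fr fi] /asboolP[gr gi]; apply/asboolP; split.
    exact: regular_functionZD.
  move=> ubar u x ul uu.
  by rewrite -[LHS]/(a * f _ + g _) fi // gi.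
- move=> f g /asboolP[fr fi] /asboolP[gr gi]; apply/asboolP; split.
    exact: regular_functionM.
  by move=> ubar u x ul uu; rewrite -[LHS]/(f _ * g _) fi // gi.
Qed.

HB.instance Definition _ := SubChoice.on BGL.
HB.instance Definition _ :=
  GRing.SubChoice_isSubAlgebra.Build C _ BGL_pred BGL BGL_subalg.
HB.instance Definition _ :=
  GRing.SubNzRing_isSubComNzRing.Build _ BGL_pred BGL.

Fact BGL_SL2_subproof (h : SL2 C) (f : BGL) :
  (fun x => val f (x *m SL2_GL n h)) \in BGL_pred.
Proof.
have /asboolP[fr fi] := valP f; apply/asboolP; split.
  by apply: (regular_function_mulmxr _ fr).
move=> ubar u x ul uu; rewrite -(fi ubar u (x *m SL2_GL n h) ul uu).
by congr (val f _); rewrite -!mulmxA SL2_GL_comm.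
Qed.

Definition BGL_SL2 (h : SL2 C) (f : BGL) : BGL :=
  exist (fun k => k \in BGL_pred) _ (BGL_SL2_subproof h f).

(* V^(lambda^+/mu). *)
Definition BGL_component (mu : dominant n.-1) (lambda : dominant n) : set BGL :=
  [set f | forall (t : 'M[C]_n) (s : 'M[C]_n.-1) (x : Mat C n),
     torus t -> torus s ->
     val f (t *m x *m diag_block n.+1 0 s) =
     weight (fun i => t i i) lambda * weight (fun i => s i i) mu * val f x].

End BGL.

Section BSp.
Variables (C : fieldType) (n : nat).

(* B = O(\bar U_(C_n) \ Sp_2n / U_(C_(n-1))).                                 *)
Definition BSp_prop (f : fct (Sp C n) C) : Prop :=
  regular_function (fun g : Sp C n => val g) f /\
  forall ubar u g : Sp C n,
    ubar \in @Ubar_C C n -> u \in @U_C_pred C n -> f (ubar * g * u)%g = f g.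

Definition BSp_pred : {pred fct (Sp C n) C} := fun f => `[< BSp_prop f >].

Definition BSp := {f : fct (Sp C n) C | f \in BSp_pred}.

Fact BSp_subalg : GRing.subsemialg_closed BSp_pred.
Proof.
apply: GRing.subalg_closed_semi; split.
- apply/asboolP; split=> //; exact: regular_function1.
- move=> a f g /asboolP[fr fi] /asboolP[gr gi]; apply/asboolP; split.
    exact: regular_functionZD.
  move=> ubar u x ul uu.
  by rewrite -[LHS]/(a * f _ + g _) fi // gi.
- move=> f g /asboolP[fr fi] /asboolP[gr gi]; apply/asboolP; split.
    exact: regular_functionM.
  by move=> ubar u x ul uu; rewrite -[LHS]/(f _ * g _) fi // gi.
Qed.

HB.instance Definition _ := SubChoice.on BSp.
HB.instance Definition _ :=
  GRing.SubChoice_isSubAlgebra.Build C _ BSp_pred BSp BSp_subalg.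
HB.instance Definition _ :=
  GRing.SubNzRing_isSubComNzRing.Build _ BSp_pred BSp.

Fact BSp_SL2_subproof (h : SL2 C) (f : BSp) :
  (fun g => val f (g * SL2_Sp n h)%g) \in BSp_pred.
Proof.
have /asboolP[fr fi] := valP f; apply/asboolP; split.
  by apply: (regular_function_mulmxr _ fr).
move=> ubar u g ul uu; rewrite -(fi ubar u (g * SL2_Sp n h)%g ul uu).
have /andP[uS _] := uu.
by congr (val f _); rewrite -!mulgA SL2_Sp_comm.
Qed.

Definition BSp_SL2 (h : SL2 C) (f : BSp) : BSp :=
  exist (fun k => k \in BSp_pred) _ (BSp_SL2_subproof h f).

Lemma leq_pred_double : (n.-1 <= n + n)%N.
Proof. exact: leq_trans (leq_pred n) (leq_addr n n). Qed.

(* W^(lambda/mu).  The first n diagonal entries of t in T_(C_n) are            *)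
(* t_1, ..., t_n, and the first n - 1 diagonal entries of s in T_(C_(n-1))     *)
(* are s_1, ..., s_(n-1).                                                      *)
Definition BSp_component (mu : dominant n.-1) (lambda : dominant n) : set BSp :=
  [set f | forall t s g : Sp C n,
     t \in @T_C C n -> s \in @T_C_pred C n ->
     val f (t * g * s)%g =
     weight (fun i : 'I_n => val t (lshift n i) (lshift n i)) lambda *
     weight (fun i : 'I_n.-1 => val s (widen_ord leq_pred_double i)
                                      (widen_ord leq_pred_double i)) mu *
     val f g].

End BSp.

Lemma psi_leq (n : nat) : (1 < n)%N -> (n.+1 <= n + n)%N.
Proof. by lia. Qed.

Definition psi (C : fieldType) (n : nat) (n_gt1 : (1 < n)%N) (g : Sp C n) :
    Mat C n :=
  mxsub (lshift n) (widen_ord (psi_leq n_gt1)) (val g).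

(* Main.v *)
Require Import Defs.
From HB Require Import structures.
From mathcomp Require Import all_boot all_order all_algebra.
From mathcomp Require Import boolp classical_sets.
From mathcomp Require Import reals complex mpoly.
From mathcomp Require Import ring zify.

Set Implicit Arguments.
Unset Strict Implicit.
Unset Printing Implicit Defensive.

Import Order.TTheory GRing.Theory Num.Theory.
Local Open Scope ring_scope.

(** Why the pullback along psi is an isomorphism.

    Write psi g = [A | b], where A is the upper-left n x n block of g and b is
    the next column.  Left multiplication by lower triangular matrices,
    right multiplication by upper triangular matrices of Sp_(2n-2), and right
    multiplication by SL_2 all commute with the truncation psi, in the sense
    made precise by [psi_triangular] and [psi_SL2].  So pulling back along psi
    is a graded, SL_2-equivariant homomorphism from B' to B.

    Injectivity.  Over the locus det A <> 0 the map psi has a section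
    ([psi_cell_section]), so its image contains a nonempty Zariski open set.

    Surjectivity.  Let f be in B.
    - If det A <> 0, the first n rows of g are [A, A Z s], where s is the
      antidiagonal matrix and Z is symmetric.  The left invariance of f makes
      f g depend on these rows only, and the right invariance under the
      symmetric matrices with zero last column makes it depend on Z only
      through its last column, that is, through b.  Hence f is the value of
      f at the section over psi g ([BSp_cell_section]), and since this section
      has only powers of det A as denominators, f * (det A)^k is a
      polynomial in psi g ([BSp_section_localized]).
    - The translates of f by SL_2 have the same property.  Translating by the
      shear that adds the last column b to the last column of A, f times a
      power of a second minor D' is a polynomial in psi g as well, where
      D' is the sum of D = det A and of the minor with b in place of the last
      column.
    - As D and D' are coprime, the denominator disappears
      ([sheared_minor_division]).  Coprimality is exploited along the pencil
      x + t [1 | 0]: there D and D' become characteristic polynomials, hence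
      monic in t, so that division by D with remainder is possible over the
      ring of polynomials in x; their resultant is a polynomial in x that is
      nonzero because it is nonzero at a pair of companion matrices with
      characteristic polynomials X^n and X^n - 1.
    - So f agrees with F o psi, for a polynomial F, where det A <> 0.  This
      locus is dense in Sp_2n ([Sp_big_cell_dense]): a unipotent line through
      a g with singular A consists, away from g, of elements whose upper-left
      block has larger rank.
    - The invariance and the weights of F follow from those of f by lifting
      GL_n and GL_(n-1) to block diagonal symplectic matrices and by density
      ([quasi_invariance_descends]).  *)

Local Notation ev x P := (P.@[fun k => mxvec x 0 k]).

(** * Polynomials *)

Section Polynomials.

Lemma poly_eq0_cofinite (C : numFieldType) (p q : {poly C}) :
  q != 0 -> (forall t, q.[t] != 0 -> p.[t] = 0) -> p = 0.
Proof.
move=> q0 pq; apply/eqP; apply: contraTT isT => p0.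
have pq0 : p * q != 0 by rewrite mulf_neq0.
pose s := [seq i%:R : C | i <- iota 0 (size (p * q))].
have us : uniq s.
  rewrite map_inj_uniq ?iota_uniq // => i j /eqP; rewrite eqr_nat => /eqP //.
have : all (root (p * q)) s.
  apply/allP => t _; rewrite rootM !rootE.
  by have [qt|qt] := eqVneq q.[t] 0; rewrite ?orbT // pq ?eqxx.
by move/(max_poly_roots pq0)/(_ us); rewrite size_map size_iota ltnn.
Qed.

(** Recombining the coefficients of a polynomial in the last variable recovers
    the multivariate polynomial. *)
Lemma muni_inj (R : comNzRingType) n : injective (@muni n R).
Proof.
pose f (P : {poly {mpoly R[n]}}) := (map_poly (@mwiden n R) P).['X_ord_max].
apply: (can_inj (g := f)); elim/mpolyind => [|c m P _ _ IH].
  by rewrite muni0 /f rmorph0 horner0.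
rewrite /f muniD rmorphD hornerD [X in _ + X]IH; congr (_ + _).
rewrite muniZ muniE msuppX big_seq1 mcoeffX eqxx scale1r.
rewrite -!mul_polyC !rmorphM /= !map_polyC map_polyXn.
rewrite !hornerM !hornerC hornerXn /= mwidenC mul_mpolyC mwidenX mpolyXn.
rewrite -mpolyXD; congr (_ *: 'X_[_]).
apply/mnmP => i; rewrite mnmDE mulmnE mnm1E.
case: (unliftP ord_max i) => [j ->|->].
  have -> : lift ord_max j = widen_ord (leqnSn n) j.
    by apply: val_inj; rewrite /= /bump leqNgt ltn_ord.
  rewrite mnmwiden_widen mnmE (_ : (_ == _) = false) ?muln0 ?addn0 //.
  by apply/eqP => /(congr1 val) /= E; have := ltn_ord j; rewrite -E ltnn.
by rewrite mnmwiden_ordmax eqxx mul1n.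
Qed.

Lemma meval_muni (R : comNzRingType) n (P : {mpoly R[n.+1]}) v :
  P.@[v] =
  (map_poly (meval (v \o widen_ord (leqnSn n))) (muni P)).[v ord_max].
Proof.
elim/mpolyind: P => [|c m P _ _ IH].
  by rewrite muni0 map_poly0 meval0 horner0.
rewrite muniD (rmorphD (map_poly _)) hornerD mevalD.
congr (_ + _); last exact: IH.
rewrite mevalZ mevalX.
rewrite muniZ muniE msuppX big_seq1 mcoeffX eqxx scale1r.
rewrite -!mul_polyC !(rmorphM (map_poly _)) /= !map_polyC map_polyXn.
rewrite !hornerM !hornerC hornerXn /= mevalC mevalX big_ord_recr /=.
by congr (_ * (_ * _)); apply: eq_bigr => i _; rewrite mnmE.
Qed.

Lemma mpoly_eq0 (C : numFieldType) n (P : {mpoly C[n]}) :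
  (forall v, P.@[v] = 0) -> P = 0.
Proof.
elim: n P => [|n IHn] P P0.
  have PE : P = (P@_0)%:MP.
    apply/mpolyP => m; rewrite mcoeffC.
    have -> : m = 0%MM by apply/mnmP => -[].
    by rewrite eqxx mulr1.
  by have := P0 (fun=> 0); rewrite PE mevalC => ->; rewrite mpolyC0.
apply: muni_inj; rewrite muni0; apply/polyP => k; rewrite coef0.
apply: IHn => v.
suff : map_poly (meval v) (muni P) = 0.
  by move/polyP/(_ k); rewrite coef_map coef0.
apply: (poly_eq0_cofinite (oner_neq0 _)) => t _.
pose w (i : 'I_n.+1) := if unlift ord_max i is Some j then v j else t.
rewrite -(P0 w) meval_muni /= /w unlift_none; congr (_.[_]).
apply: eq_map_poly => p; apply: meval_eq => i /=.
have -> : widen_ord (leqnSn n) i = lift ord_max i.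
  by apply: val_inj; rewrite /= /bump leqNgt ltn_ord.
by rewrite liftK.
Qed.

(** Restriction of a polynomial to an affine line; density arguments on
    varieties that are not affine spaces are made along such lines. *)
Lemma mpoly_line (C : comNzRingType) n (P : {mpoly C[n]}) (v e : 'I_n -> C) :
  exists p : {poly C}, forall t, P.@[fun k => v k + t * e k] = p.[t].
Proof.
exists (mmap polyC (fun k => (v k)%:P + (e k)%:P * 'X) P) => t.
elim/mpolyind: P => [|c m P _ _ IH]; first by rewrite meval0 mmap0 horner0.
rewrite mevalD mmapD hornerD IH mevalZ mmapZ hornerM hornerC mevalX mmapX.
rewrite /mmap1 horner_prod; congr (_ * _ + _); apply: eq_bigr => i _.
by rewrite horner_exp !hornerE mulrC.
Qed.

(** The remainder of the division by a monic polynomial is compatible with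
    multiplication by scalars, so a nonzero scalar does not affect
    divisibility, even if the scalar is not invertible. *)
Lemma monic_dvd_cancel (R : idomainType) (p P : {poly R}) (c : R) :
  p \is monic -> c != 0 -> (exists F, c *: P = p * F) -> exists F, P = p * F.
Proof.
move=> pm c0 [F PF]; exists (Pdiv.Ring.rdivp P p).
have E := Pdiv.RingMonic.rdivp_eq pm P.
set r := Pdiv.Ring.rmodp P p in E; set d := Pdiv.Ring.rdivp P p in E *.
have sr : (size r < size p)%N.
  by apply: Pdiv.Ring.ltn_rmodpN0; rewrite monic_neq0.
suff r0 : r = 0 by rewrite E r0 addr0 mulrC.
have : c *: r = p * (F - c *: d).
  by rewrite mulrBr -PF {1}E scalerDr -!scalerAr addrAC [d * p]mulrC subrr add0r.
move=> H; case: (eqVneq (F - c *: d) 0) H => [->|n0 H].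
  by move/eqP; rewrite mulr0 scale_poly_eq0 (negPf c0) => /eqP.
have := leq_ltn_trans (size_scale_leq c r) sr.
rewrite H size_monicM //; move: n0; rewrite -size_poly_gt0; lia.
Qed.

(** A nonzero resultant is a combination u p + v q, hence modulo p a power of it
    times P is a multiple of q ^+ l * P, which p divides; the resultant is a
    scalar and is then removed by [monic_dvd_cancel]. *)
Lemma monic_dvd_coprime (R : idomainType) (p q P Q : {poly R}) (k l : nat) :
  p \is monic -> (1 < size p)%N -> (1 < size q)%N -> resultant p q != 0 ->
  q ^+ l * P = p ^+ k * Q -> exists F, P = p ^+ k * F.
Proof.
move=> pm sp sq rho0; elim: k P => [|k IHk] P; first by exists P; rewrite mul1r.
move=> H.
have [P1 P1E] : exists F, P = p * F.
  apply: (@monic_dvd_cancel _ p P (resultant p q ^+ l) pm).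
    exact: expf_neq0.
  have [[u v] /= _ uvE] := resultant_in_ideal sp sq.
  have [w wE] : exists w, (u * p + v * q) ^+ l = p * w + (v * q) ^+ l.
    elim: l {H IHk} => [|l [w IH]]; first by exists 0; rewrite mulr0 add0r.
    by eexists (u * (p * w + (v * q) ^+ l) + v * q * w); rewrite !exprS IH; ring.
  exists (w * P + v ^+ l * (p ^+ k * Q)).
  rewrite -mul_polyC rmorphXn /= uvE wE mulrDl exprMn -mulrA -mulrA H exprS; ring.
have [F FE] : exists F, P1 = p ^+ k * F.
  apply: IHk; apply: (mulfI (monic_neq0 pm)).
  by rewrite mulrCA -P1E H exprS mulrA.
by exists F; rewrite P1E FE exprS mulrA.
Qed.

(** Specialization of resultants, which may fail when a leading coefficient
    vanishes under f. *)
Lemma resultant_map (aR rR : nzRingType) (f : {rmorphism aR -> rR}) p q :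
    f (lead_coef p) != 0 -> f (lead_coef q) != 0 ->
  f (resultant p q) = resultant (map_poly f p) (map_poly f q).
Proof.
move=> nz_fp nz_fq; rewrite /resultant /Sylvester_mx !size_map_poly_id0 //.
rewrite -det_map_mx /= map_col_mx; congr (\det (col_mx _ _));
  by apply: map_lin1_mx => v; rewrite map_poly_rV rmorphM /= map_rVpoly.
Qed.

End Polynomials.

(** * Divisibility by a maximal minor *)

Section MinorDivision.
Variables (C : numFieldType) (p q : nat).
Implicit Types (x E : 'M[C]_(p, q)) (S : 'M[C]_(q, p)).

Definition generic_mx : 'M[{mpoly C[p * q]}]_(p, q) :=
  \matrix_(i, j) 'X_(mxvec_index i j).

Lemma meval_generic_mx x : map_mx (meval (fun k => mxvec x 0 k)) generic_mx = x.
Proof. by apply/matrixP => i j; rewrite !mxE mevalXU mxvecE. Qed.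

Definition generic_minor S : {mpoly C[p * q]} :=
  \det (generic_mx *m map_mx (@mpolyC _ C) S).

Lemma meval_generic_minor S x : ev x (generic_minor S) = \det (x *m S).
Proof.
rewrite -det_map_mx map_mxM meval_generic_mx -map_mx_comp; congr (\det (_ *m _)).
by apply/matrixP => i j; rewrite mxE /= mevalC.
Qed.

Lemma meval_generic_minorXM S x k (P : {mpoly C[p * q]}) :
  ev x (generic_minor S ^+ k * P) = \det (x *m S) ^+ k * ev x P.
Proof. by rewrite mevalM rmorphXn /= meval_generic_minor. Qed.

(** Substituting x + t E for x turns the two minors into the characteristic
    polynomials, in t, of - x S1 and - x S2, which are monic.  Their resultant
    is a polynomial in x that does not vanish at x0, so
    [monic_dvd_coprime] applies over the ring of polynomials in x; setting
    t = 0 in the quotient gives F. *)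
Lemma minor_division S1 S2 E x0 (P Q : {mpoly C[p * q]}) (k l : nat) :
  (0 < p)%N -> E *m S1 = 1%:M -> E *m S2 = 1%:M ->
  coprimep (char_poly (- (x0 *m S1))) (char_poly (- (x0 *m S2))) ->
  (forall x, \det (x *m S2) ^+ l * ev x P = \det (x *m S1) ^+ k * ev x Q) ->
  exists F : {mpoly C[p * q]},
    forall x, ev x P = \det (x *m S1) ^+ k * ev x F.
Proof.
move=> p_gt0 ES1 ES2 cop H.
(* The substitution of x + t E for x, where t is the variable of the outer
   polynomial ring. *)
pose shift : {mpoly C[p * q]} -> {poly {mpoly C[p * q]}} :=
  mmap (polyC \o @mpolyC _ C)
       (fun k => ('X_k)%:P + (mxvec E 0 k)%:MP%:P * 'X).
have shift0 (T : {mpoly C[p * q]}) : (shift T).[0] = T.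
  elim/mpolyind: T => [|c m T _ _ IH]; first by rewrite /shift mmap0 horner0.
  rewrite /shift mmapD hornerD; congr (_ + _); last exact: IH.
  rewrite mmapZ mmapX /= hornerM hornerC mul_mpolyC; congr (_ *: _).
  rewrite /mmap1 horner_prod [RHS]mpolyXE_id; apply: eq_bigr => i _.
  by rewrite horner_exp !hornerE ?mulr0 ?addr0.
pose chi S := char_poly (- (generic_mx *m map_mx (@mpolyC (p * q) C) S)).
have chi_monic S : chi S \is monic by apply: char_poly_monic.
have chi_size S : size (chi S) = p.+1 by apply: size_char_poly.
have shift_minor S : E *m S = 1%:M -> shift (generic_minor S) = chi S.
  move=> ES; rewrite /shift -det_map_mx map_mxM; congr (\det _).
  rewrite (_ : map_mx _ generic_mx =
      map_mx polyC generic_mx + 'X *: map_mx (polyC \o @mpolyC (p * q) C) E).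
    rewrite (_ : map_mx _ (map_mx _ S) = map_mx (polyC \o @mpolyC (p * q) C) S).
      rewrite mulmxDl -scalemxAl -map_mxM ES map_mx1 /char_poly_mx.
      rewrite map_mxN opprK scalemx1 addrC; congr (_ + _).
      by rewrite map_mxM /=; congr (_ *m _); rewrite -map_mx_comp.
    by apply/matrixP => i j; rewrite !mxE /= mmapC.
  apply/matrixP => i j; rewrite !mxE /= mmapX mmap1U mxvecE.
  by rewrite ['X * _]mulrC.
have shiftXM S m T : shift (generic_minor S ^+ m * T) =
    shift (generic_minor S) ^+ m * shift T.
  by rewrite /shift rmorphM rmorphXn.
have chi_res : resultant (chi S1) (chi S2) != 0.
  apply: contraTneq cop => res0.
  pose at_x0 := meval (fun k => mxvec x0 0 k).
  have spec_chi S : map_poly at_x0 (chi S) = char_poly (- (x0 *m S)).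
    rewrite map_char_poly map_mxN map_mxM meval_generic_mx -map_mx_comp.
    congr (char_poly (- (_ *m _))).
    by apply/matrixP => i j; rewrite mxE /= mevalC.
  have spec_lead S : at_x0 (lead_coef (chi S)) != 0.
    by rewrite (monicP (chi_monic S)) /at_x0 meval1 oner_neq0.
  have : resultant (map_poly at_x0 (chi S1)) (map_poly at_x0 (chi S2)) = 0.
    apply: etrans (esym (resultant_map (spec_lead S1) (spec_lead S2))) _.
    by rewrite res0; exact: meval0.
  move=> /(etrans (esym (f_equal2 resultant (spec_chi S1) (spec_chi S2))))/eqP.
  by rewrite resultant_eq0 coprimep_def; case: ltngtP.
have HR : generic_minor S2 ^+ l * P = generic_minor S1 ^+ k * Q.
  apply/subr0_eq/mpoly_eq0 => v.
  have vE : v =1 (fun k => mxvec (vec_mx (\row_k v k)) 0 k).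
    by move=> i; rewrite vec_mxK mxE.
  rewrite (meval_eq _ vE) mevalB !mevalM !rmorphXn /=.
  apply/eqP; rewrite subr_eq0; apply/eqP; apply: etrans (etrans _ (H _)) _.
    by congr (_ ^+ _ * _); exact: meval_generic_minor.
  by congr (_ ^+ _ * _); exact/esym/meval_generic_minor.
have HP : chi S2 ^+ l * shift P = chi S1 ^+ k * shift Q.
  rewrite -(shift_minor S1 ES1) -(shift_minor S2 ES2) -(shiftXM S2 l).
  by rewrite HR shiftXM.
have chi_gt1 S : (1 < size (chi S))%N by rewrite chi_size.
have [F FE] :=
  monic_dvd_coprime (chi_monic S1) (chi_gt1 S1) (chi_gt1 S2) chi_res HP.
exists F.[0] => x; rewrite -meval_generic_minor -rmorphXn -mevalM.
congr (meval _ _); rewrite -[LHS]shift0 FE hornerM horner_exp.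
by rewrite -(shift_minor S1 ES1) shift0.
Qed.

End MinorDivision.

Definition principal_cols (C : fieldType) (n : nat) : 'M[C]_(n.+1, n) :=
  block_incl C n n.+1 0.

Section ShearedMinor.
Variables (C : numFieldType) (n : nat).
Hypothesis n_gt0 : (0 < n)%N.

Local Notation principal_cols := (principal_cols C n).

Lemma char_poly_trmx (A : 'M[C]_n) : char_poly A^T = char_poly A.
Proof.
rewrite /char_poly -det_tr; congr (\det _).
by rewrite /char_poly_mx linearB /= tr_scalar_mx map_trmx trmxK.
Qed.

(** [companionmx p] has size (size p).-1, which is n only up to a rewriting;
    this version has its entries in a square matrix of size n. *)
Lemma companion_exists (p : {poly C}) : p \is monic -> size p = n.+1 ->
  exists2 M : 'M[C]_n, char_poly M = p &
    forall i j, M i j =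
      if (i == n.-1 :> nat) then - p`_j else (i.+1 == j :> nat)%:R.
Proof.
move=> pm sp; have := companionmxK pm; rewrite /companionmx sp => pE.
exists (\matrix_(i, j)
   if (i == n.-1 :> nat) then - p`_j else (i.+1 == j :> nat)%:R) => // i j.
by rewrite mxE.
Qed.

Fact shear_det : \det (\matrix_(i < 2, j < 2) (j <= i)%:R : 'M[C]_2) == 1.
Proof.
rewrite det_trig; first by rewrite big1 // => i _; rewrite mxE leqnn.
by apply/is_trig_mxP => i j ij; rewrite mxE leqNgt ij.
Qed.

(** Its right action adds the last column of an n x (n+1) matrix to the
    preceding one.  Unlike the exchange of these columns, it has 1 in its upper
    left corner, so that both minors restrict to monic polynomials on the same
    pencil. *)
Definition shear : SL2 C := exist (fun k : 'M[C]_2 => \det k == 1) _ shear_det.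

Lemma tr_block_incl_mulE k k' N o o' (a : 'I_k) (b : 'I_k') : (o + a < N)%N ->
  ((block_incl C k N o)^T *m block_incl C k' N o') a b = (o + a == o' + b)%:R.
Proof.
move=> lt; rewrite mxE (bigD1 (Ordinal lt)) //= !mxE eqxx mul1r eq_sym.
rewrite big1 ?addr0 // => i iN; rewrite !mxE.
case: eqP => [E|]; last by rewrite mul0r.
by case/eqP: iN; apply: val_inj.
Qed.

Lemma shear_principal_cols : exists2 i0 : 'I_n, i0 = n.-1 :> nat &
  SL2_GL n shear *m principal_cols = principal_cols + delta_mx ord_max i0.
Proof.
have lt : (n.-1 < n)%N by rewrite prednK.
exists (Ordinal lt) => //; rewrite /SL2_GL diag_blockE.
rewrite mulmxDl mul1mx; congr (_ + _); apply/matrixP => i j.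
have -> : val shear - 1%:M = delta_mx 1 0 :> 'M[C]_2.
  by apply/matrixP => -[[|[|//]] ?] [[|[|//]] ?]; rewrite !mxE /= ?subr0 ?subrr.
have aN (a : 'I_2) : (n.-1 + a < n.+1)%N by have := ltn_ord a; lia.
rewrite -mulmxA mxE !big_ord_recl big_ord0 !tr_block_incl_mulE ?aN //.
rewrite !mxE !big_ord_recl !big_ord0 !mxE /= -!val_eqE /=.
have := ltn_ord j; have := ltn_ord i => iN jN; rewrite !mulr0 !mulr1 !add0r !addr0.
rewrite ?mul0r ?addr0 -natrM mulnb /bump /=; congr (nat_of_bool _)%:R; lia.
Qed.

Lemma principal_colsTK : principal_cols^T *m principal_cols = 1%:M.
Proof. by apply: block_inclTK; rewrite add0n. Qed.

Lemma principal_colsT_delta (i : 'I_n) :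
  principal_cols^T *m delta_mx ord_max i = 0.
Proof.
apply/matrixP => j k; rewrite mxE big1 ?mxE // => l _; rewrite !mxE -!val_eqE /=.
case: eqP => [<-|]; rewrite ?mul0r //.
by rewrite [_ == n]ltn_eqF ?mulr0 // add0n.
Qed.

(** The coprimality required by [minor_division] is checked at an x0 for which
    both n x n blocks are, up to sign and transposition, the companion matrices
    of X^n and X^n - 1: these differ in one column only. *)
Lemma sheared_minor_division (P Q : {mpoly C[n * n.+1]}) (k l : nat) :
  (forall x : 'M[C]_(n, n.+1),
     \det (x *m SL2_GL n shear *m principal_cols) ^+ l * ev x P =
     \det (x *m principal_cols) ^+ k * ev x Q) ->
  exists F : {mpoly C[n * n.+1]}, forall x : 'M[C]_(n, n.+1),
    ev x P = \det (x *m principal_cols) ^+ k * ev x F.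
Proof.
move=> H; have [i0 i0E HS] := shear_principal_cols.
have [M1 M1c M1E] := companion_exists (monicXn C n) (size_polyXn C n).
(* The companion matrices of X^n and X^n - 1 differ in the constant term of the
   polynomial only. *)
have [M2 M2c M2E] : exists2 M : 'M[C]_n, char_poly M = 'X^n - 1 &
    M = M1 + delta_mx i0 (Ordinal n_gt0).
  have [|M Mc ME] := companion_exists (monicXnsubC 1 n_gt0).
    by rewrite size_XnsubC.
  exists M => //; apply/matrixP => i j; rewrite ME !mxE M1E coefB coefC !coefXn.
  rewrite -!val_eqE /= i0E.
  case: eqP => _; rewrite ?addr0 // opprB addrC.
  by case: (j : nat) => [|?]; rewrite ?eqxx.
pose x0 : 'M[C]_(n, n.+1) :=
  - M1^T *m principal_cols^T - delta_mx (Ordinal n_gt0) ord_max.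
have x0S : x0 *m principal_cols = - M1^T.
  rewrite mulmxBl -mulmxA principal_colsTK mulmx1.
  rewrite -[delta_mx _ _ *m _]trmxK trmx_mul trmx_delta principal_colsT_delta.
  by rewrite trmx0 subr0.
have x0HS : x0 *m (SL2_GL n shear *m principal_cols) = - M2^T.
  rewrite HS mulmxDr x0S M2E [in RHS]linearD opprD /=; congr (_ + _).
  rewrite mulmxBl -mulmxA trmx_delta mul_delta_mx principal_colsT_delta.
  by rewrite mulmx0 sub0r.
have HS1 : principal_cols^T *m (SL2_GL n shear *m principal_cols) = 1%:M.
  by rewrite HS mulmxDr principal_colsTK principal_colsT_delta addr0.
apply: (minor_division (E := principal_cols^T) (x0 := x0) n_gt0
  (Q := Q) (l := l) principal_colsTK HS1).
- rewrite x0S x0HS !opprK !char_poly_trmx M1c M2c.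
  apply/Bezout_eq1_coprimepP; exists (1, -1).
  by rewrite mul1r mulN1r opprB addrC subrK.
- by move=> x; rewrite mulmxA; exact: H.
Qed.

End ShearedMinor.

(** * Symplectic block matrices *)

Section TriangularInverse.
Variables (C : fieldType) (n : nat).
Implicit Types a b : 'M[C]_n.

(** Row i of a *m b = 1, read from the top, determines row i of b from the rows
    above it. *)
Lemma trig_inv a b : is_trig_mx a -> a *m b = 1%:M ->
  is_trig_mx b /\ forall i, a i i * b i i = 1.
Proof.
move=> /is_trig_mxP at0 ab1.
have aU : a \in unitmx by case: (mulmx1_unit ab1).
have an0 i : a i i != 0.
  apply: contraTneq aU => ai0; rewrite unitmxE det_trig; last exact/is_trig_mxP.
  by rewrite unitfE (bigD1 i) //= ai0 mul0r eqxx.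
have bt : is_trig_mx b.
  apply/is_trig_mxP => i; have [m] := ubnP i; elim: m i => // m IHm i im j ij.
  have /matrixP/(_ i j) := ab1; rewrite !mxE (bigD1 i) //= big1 => [|k ki].
    rewrite addr0 -val_eqE ltn_eqF // => /eqP.
    by rewrite mulf_eq0 (negPf (an0 i)) => /eqP.
  case: (ltngtP k i) => [lt|gt|/val_inj E]; last by rewrite E eqxx in ki.
    by rewrite IHm ?mulr0 //; [exact: leq_trans lt im | exact: ltn_trans ij].
  by rewrite at0 ?mul0r.
split=> // i; have /matrixP/(_ i i) := ab1; rewrite !mxE eqxx (bigD1 i) //= big1.
  by rewrite addr0.
move=> k ki; case: (ltngtP k i) => [lt|gt|/val_inj E]; last by rewrite E eqxx in ki.
  by rewrite (is_trig_mxP bt) ?mulr0.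
by rewrite at0 ?mul0r.
Qed.

End TriangularInverse.

Section SymplecticBlocks.
Variables (C : fieldType) (n : nat).
Local Notation s := (antidiag C n).
Implicit Types (a b Y : 'M[C]_n) (g h : Sp C n).

Lemma Sp_valM g h : val (g * h)%g = val g *m val h. Proof. by []. Qed.

Lemma tr_antidiag : s^T = s.
Proof.
apply/matrixP => i j; rewrite !mxE; congr (_ %:R).
by rewrite -(inj_eq rev_ord_inj) rev_ordK eq_sym.
Qed.

Lemma mul_antidiagE m (B : 'M[C]_(m, n)) i j : (B *m s) i j = B i (rev_ord j).
Proof.
rewrite mxE (bigD1 (rev_ord j)) //= mxE rev_ordK eqxx mulr1 big1 ?addr0 // => k kj.
rewrite mxE (_ : (_ == _) = false) ?mulr0 //; apply: contra_neqF kj => /eqP ->.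
by rewrite rev_ordK.
Qed.

Lemma conj_antidiagE a i j : (s *m a *m s) i j = a (rev_ord i) (rev_ord j).
Proof.
by rewrite mul_antidiagE -[s *m a]trmxK trmx_mul tr_antidiag mxE mul_antidiagE mxE.
Qed.

Lemma e_posE (i : 'I_n) : e_pos C i = col_mx (delta_mx i 0) 0.
Proof.
apply/matrixP => k l; rewrite !ord1; case: (split_ordP k) => m ->;
  rewrite ?col_mxEu ?col_mxEd !mxE -!val_eqE //= andbT.
by rewrite gtn_eqF //; have := ltn_ord i; lia.
Qed.

Lemma e_negE (i : 'I_n) : e_neg C i = col_mx 0 (s *m delta_mx i 0).
Proof.
apply/matrixP => k l; rewrite !ord1; case: (split_ordP k) => m ->;
  rewrite ?col_mxEu ?col_mxEd -?colE !mxE -!val_eqE //= ?andbT.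
  by rewrite ltn_eqF //; have := ltn_ord m; have := ltn_ord i; lia.
by congr (nat_of_bool _)%:R; have := ltn_ord m; have := ltn_ord i; lia.
Qed.

Lemma symplectic_mulJ g : val g *m Jmx n *m (val g)^T = Jmx n.
Proof.
have /eqP gJ := valP g.
have : - Jmx n *m (val g)^T *m Jmx n *m val g = 1%:M.
  by rewrite -!mulmxA [(val g)^T *m _]mulmxA gJ mulNmx JmxK opprK.
move/mulmx1C/(congr1 (mulmx^~ (Jmx n))).
by rewrite -!mulmxA JmxK mul1mx !mulNmx !mulmxN mulmx1 opprK.
Qed.

(** The first n rows of a symplectic matrix span an isotropic subspace. *)
Lemma symplectic_isotropic g :
  ulsubmx (val g) *m s *m (ursubmx (val g))^T =
  ursubmx (val g) *m s *m (ulsubmx (val g))^T.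
Proof.
have := symplectic_mulJ g.
rewrite -[val g]submxK; set A := ulsubmx _; set B := ursubmx _.
rewrite /Jmx tr_block_mx !mulmx_block !mulmx0 !add0r !addr0 mulmxN mulNmx.
move/eq_block_mx => [/eqP + _ _ _].
by rewrite addrC subr_eq0 => /eqP H; rewrite !block_mxKul !block_mxKur.
Qed.

(** The Levi factor of the stabilizer of a Lagrangian subspace, for b the
    inverse of a.  Keeping b as a parameter makes the transposition symmetry
    [tr_levi_mx] hold without any hypothesis. *)
Definition levi_mx a b : 'M[C]_(n + n) := block_mx a 0 0 (s *m b^T *m s).

Lemma levi_mx_symplectic a b : b *m a = 1%:M -> symplectic (levi_mx a b).
Proof.
move=> ba1; apply/eqP; rewrite /levi_mx /Jmx tr_block_mx !mulmx_block.
rewrite !trmx0 !mul0mx !mulmx0 !addr0 !add0r !mul0mx.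
have abT : a^T *m b^T = 1%:M by rewrite -trmx_mul ba1 trmx1.
congr block_mx.
  by rewrite !mulmxA -[_ *m s *m s]mulmxA antidiagK mulmx1 abT mul1mx.
rewrite !trmx_mul tr_antidiag trmxK mulmxN mulNmx -!mulmxA; congr (- _).
by rewrite [s *m (s *m a)]mulmxA antidiagK mul1mx ba1 mulmx1.
Qed.

Lemma tr_levi_mx a b : (levi_mx a b)^T = levi_mx a^T b^T.
Proof.
by rewrite /levi_mx tr_block_mx !trmx0 !trmx_mul tr_antidiag trmxK mulmxA.
Qed.

Lemma levi_mx_trig a b : is_trig_mx a -> is_trig_mx b -> is_trig_mx (levi_mx a b).
Proof.
move=> at0 /is_trig_mxP bt0; rewrite is_trig_block_mx // eqxx at0 /=.
apply/is_trig_mxP => i j ij; rewrite conj_antidiagE mxE bt0 //=.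
by have := ltn_ord i; have := ltn_ord j; lia.
Qed.

Definition levi a : Sp C n := insubd (1%g : Sp C n) (levi_mx a (invmx a)).

Lemma val_levi a : a \in unitmx -> val (levi a) = levi_mx a (invmx a).
Proof.
by move=> aU; rewrite insubdK //; apply: levi_mx_symplectic; rewrite mulVmx.
Qed.

Lemma levi_lower_unip a : a \in unitmx -> lower_unip a -> lower_unip (val (levi a)).
Proof.
move=> aU /andP[at0 /forallP a1]; rewrite val_levi //.
have [bt0 b1] := trig_inv at0 (mulmxV aU).
rewrite /lower_unip levi_mx_trig //=; apply/forallP => i.
case: (split_ordP i) => k ->; rewrite /levi_mx ?block_mxEul ?block_mxEdr //.
rewrite conj_antidiagE mxE; have := b1 (rev_ord k).
by rewrite (eqP (a1 _)) mul1r => ->.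
Qed.

Lemma levi_upper_unip a : a \in unitmx -> upper_unip a -> upper_unip (val (levi a)).
Proof.
move=> aU; rewrite /upper_unip => au.
have aTU : a^T \in unitmx by rewrite unitmx_tr.
have := levi_lower_unip aTU au.
by rewrite !val_levi // tr_levi_mx trmx_inv.
Qed.

Lemma levi_torus a : torus a -> torus (val (levi a)).
Proof.
move=> /andP[]; rewrite /torus is_diag_mxEtrig => /andP[al au] aU.
rewrite (symplectic_unit (valP (levi a))) andbT is_diag_mxEtrig val_levi //.
have [bl _] := trig_inv al (mulmxV aU).
have [|bu _] := trig_inv au (b := (invmx a)^T).
  by rewrite -trmx_mul mulVmx // trmx1.
by rewrite levi_mx_trig // tr_levi_mx levi_mx_trig.
Qed.

Definition upper_siegel_mx Y : 'M[C]_(n + n) := block_mx 1%:M (Y *m s) 0 1%:M.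
Definition lower_siegel_mx Y : 'M[C]_(n + n) := block_mx 1%:M 0 (s *m Y) 1%:M.

Lemma upper_siegel_mx_symplectic Y : Y^T = Y -> symplectic (upper_siegel_mx Y).
Proof.
move=> YT; apply/eqP; rewrite /upper_siegel_mx /Jmx tr_block_mx !mulmx_block.
rewrite !trmx1 !trmx0 !mul0mx !mulmx0 !addr0 !add0r !mul1mx !mulmx1.
rewrite ?mul0mx ?add0r ?addr0 trmx_mul tr_antidiag YT; congr block_mx.
by rewrite mulNmx mulmxA addrC subrr.
Qed.

Lemma lower_siegel_mx_symplectic Y : Y^T = Y -> symplectic (lower_siegel_mx Y).
Proof.
move=> YT; apply/eqP; rewrite /lower_siegel_mx /Jmx tr_block_mx !mulmx_block.
rewrite !trmx1 !trmx0 !mul0mx !mulmx0 !addr0 !add0r !mul1mx !mulmx1.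
rewrite ?mul0mx ?add0r ?addr0 trmx_mul tr_antidiag YT; congr block_mx.
by rewrite mulmxN mulmxA -[Y *m s *m s]mulmxA !antidiagK mulmx1 mul1mx addrC subrr.
Qed.

Definition upper_siegel Y : Sp C n := insubd (1%g : Sp C n) (upper_siegel_mx Y).
Definition lower_siegel Y : Sp C n := insubd (1%g : Sp C n) (lower_siegel_mx Y).

Lemma val_upper_siegel Y : Y^T = Y -> val (upper_siegel Y) = upper_siegel_mx Y.
Proof. by move=> YT; rewrite insubdK //; apply: upper_siegel_mx_symplectic. Qed.

Lemma val_lower_siegel Y : Y^T = Y -> val (lower_siegel Y) = lower_siegel_mx Y.
Proof. by move=> YT; rewrite insubdK //; apply: lower_siegel_mx_symplectic. Qed.

(** The quotient of two symplectic matrices with the same first n rows has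
    [1, 0] as first n rows, and the symplectic condition then forces its
    lower-right block to be 1. *)
Lemma usubmx_eq_Ubar g h : usubmx (val g) = usubmx (val h) ->
  (g * h^-1)%g \in @Ubar_C C n.
Proof.
move=> gh; set k := (g * h^-1)%g.
have kE : usubmx (val k) = row_mx 1%:M 0.
  rewrite [val k]/(val g *m invmx (val h)) -mul_usub_mx gh mul_usub_mx.
  rewrite mulmxV ?symplectic_unit ?(valP h) //.
  by rewrite (@scalar_mx_block _ n n) block_mxEv col_mxKu.
have kB : val k = block_mx 1%:M 0 (dlsubmx (val k)) (drsubmx (val k)).
  by rewrite -[LHS]vsubmxK kE block_mxEv hsubmxK.
have k1 : drsubmx (val k) = 1%:M.
  have := eqP (valP k); rewrite kB /Jmx tr_block_mx !mulmx_block block_mxKdr.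
  rewrite !trmx1 !trmx0 !mul0mx !mulmx0 !addr0 !add0r !mul1mx.
  move/eq_block_mx => [_ + _ _] => /(congr1 (mulmx s)).
  by rewrite mulmxA antidiagK mul1mx.
change (lower_unip (val k)); rewrite kB k1 /lower_unip.
rewrite is_trig_block_mx // eqxx !scalar_mx_is_trig /=.
by apply/forallP => i; case: (split_ordP i) => j ->;
  rewrite ?block_mxEul ?block_mxEdr mxE eqxx.
Qed.

End SymplecticBlocks.

(** * Density of the big cell of the symplectic group *)

Section BigCell.
Variables (C : numFieldType) (n : nat).
Local Notation s := (antidiag C n).

(** Take v with v A = 0, and Y = z z^T of rank one, with (v B s) z <> 0.  By
    isotropy (v B s)^T is killed by A, so a row u killed by A + t B s Y satisfies
    t (u B s z) (z^T (v B s)^T) = 0, hence u B s z = 0 and u A = 0.  The left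
    kernel thus shrinks, strictly as v is no longer in it. *)
Lemma increase_rank (g : Sp C n) : ulsubmx (val g) \notin unitmx ->
  exists2 Y : 'M[C]_n, Y^T = Y &
    forall t, t != 0 ->
      (\rank (ulsubmx (val g)) <
       \rank (ulsubmx (val (g * lower_siegel (t *: Y))%g)))%N.
Proof.
set A := ulsubmx _; set B := ursubmx (val g) => AU.
have [v v0 vA] : exists2 v : 'rV_n, v != 0 & v *m A = 0.
  have : kermx A != 0 by rewrite kermx_eq0 row_free_unit.
  by case/rowV0Pn => v /sub_kermxP vA v0; exists v.
(* Otherwise v would annihilate the first n rows of the invertible g. *)
have w0 : v *m B *m s != 0.
  apply: contraNneq v0 => w0.
  have vB : v *m B = 0.
    by rewrite -[_ *m B]mulmx1 -(antidiagK C n) mulmxA w0 mul0mx.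
  have gU := symplectic_unit (valP g).
  have : row_mx v 0 *m val g = 0.
    by rewrite -[val g]submxK mul_row_block !mul0mx !addr0 vA vB row_mx0.
  move/(congr1 (mulmx^~ (invmx (val g)))).
  rewrite /= -mulmxA mulmxV // mulmx1 mul0mx.
  by move/(congr1 lsubmx); rewrite row_mxKl linear0 => ->.
set w := v *m B *m s in w0.
have [j wj] : exists j, w 0 j != 0 by apply/rV0Pn.
pose z : 'cV[C]_n := delta_mx j 0.
have wz : w *m z = (w 0 j)%:M.
  by rewrite -colE; apply/matrixP => a b; rewrite !ord1 !mxE mulr1n.
have YT : (z *m z^T)^T = z *m z^T by rewrite trmx_mul trmxK.
exists (z *m z^T) => // t t0.
have A'E : ulsubmx (val (g * lower_siegel (t *: (z *m z^T)))%g) =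
    A + t *: (B *m s *m z *m z^T).
  rewrite Sp_valM val_lower_siegel ?linearZ /= ?YT //.
  rewrite -[val g]submxK mulmx_block block_mxKul mulmx1 -/A -/B; congr (_ + _).
  by rewrite -scalemxAr -scalemxAr !mulmxA.
rewrite A'E; set A' := A + _.
have Aw : A *m w^T = 0.
  rewrite !trmx_mul tr_antidiag !mulmxA symplectic_isotropic -!mulmxA.
  by rewrite -trmx_mul vA trmx0 !mulmx0.
have vA' : v *m A' = t *: ((w 0 j)%:M *m z^T).
  by rewrite mulmxDr vA add0r -scalemxAr !mulmxA -/w wz.
have kerA' u : u *m A' = 0 -> u *m A = 0 :> 'rV_n.
  move=> uA'; have := congr1 (mulmx^~ w^T) uA'.
  rewrite /= mul0mx /A' mulmxDr mulmxDl -mulmxA Aw mulmx0 add0r.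
  rewrite -scalemxAr -scalemxAl.
  rewrite !mulmxA -[_ *m z^T *m w^T]mulmxA -trmx_mul wz tr_scalar_mx mul_mx_scalar.
  move/eqP; rewrite !scaler_eq0 (negPf t0) (negPf wj) /= => /eqP uz.
  by move: uA'; rewrite /A' mulmxDr -scalemxAr !mulmxA uz mul0mx scaler0 addr0.
have lt : (kermx A' < kermx A)%MS.
  rewrite ltmxE; apply/andP; split.
    by apply/rV_subP => u /sub_kermxP/kerA' uA; apply/sub_kermxP.
  apply/negP => /rV_subP/(_ v); have vk : (v <= kermx A)%MS by apply/sub_kermxP.
  move/(_ vk)/sub_kermxP; rewrite vA' mul_scalar_mx => /eqP.
  rewrite !scaler_eq0 (negPf t0) (negPf wj) /= => /eqP/(congr1 trmx).
  rewrite trmxK trmx0 => z0; move: wz wj; rewrite z0 mulmx0 => /matrixP/(_ 0 0).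
  by rewrite !mxE mulr1n => <-; rewrite eqxx.
have := rank_ltmx lt; rewrite !mxrank_ker.
by have := rank_leq_row A; have := rank_leq_row A'; lia.
Qed.

(** Induction on the corank of the upper-left block: along the line of
    [increase_rank], f is a polynomial in one variable that vanishes away from
    0 by induction. *)
Lemma Sp_big_cell_dense (f : fct (Sp C n) C) :
  regular_function (fun g : Sp C n => val g) f ->
  (forall g, ulsubmx (val g) \in unitmx -> f g = 0) -> forall g, f g = 0.
Proof.
move=> [P fP] f0 g; have [m] := ubnP (n - \rank (ulsubmx (val g))).
elim: m g => // m IHm g rg.
have [/f0 //|AU] := boolP (ulsubmx (val g) \in unitmx).
have [Y YT Yr] := increase_rank AU.
have tYT t : (t *: Y)^T = t *: Y by rewrite linearZ /= YT.
pose D : 'M_(n + n) := val g *m block_mx 0 0 (s *m Y) 0.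
have gtE t : val (g * lower_siegel (t *: Y))%g = val g + t *: D.
  rewrite Sp_valM val_lower_siegel // scalemxAr.
  rewrite -[X in X + _](mulmx1 (val g)) -mulmxDr; congr (_ *m _).
  rewrite (@scalar_mx_block _ n n) scale_block_mx add_block_mx.
  by rewrite !scaler0 !addr0 add0r /lower_siegel_mx -scalemxAr.
have [p pE] := mpoly_line P (fun k => mxvec (val g) 0 k) (fun k => mxvec D 0 k).
have pf t : p.[t] = f (g * lower_siegel (t *: Y))%g.
  rewrite -pE fP; apply: meval_eq => k.
  by rewrite gtE linearD linearZ /= !mxE.
have p0 : p = 0.
  apply: (@poly_eq0_cofinite _ _ 'X); first by rewrite polyX_eq0.
  move=> t; rewrite hornerX => t0; rewrite pf; apply: IHm.
  rewrite ltnS in rg; apply: leq_trans rg; apply: ltn_sub2l (Yr t t0).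
  exact: leq_trans (Yr t t0) (rank_leq_row _).
have := pf 0; rewrite p0 horner0 scale0r => ->; congr f.
apply: val_inj; rewrite Sp_valM val_lower_siegel ?trmx0 //.
rewrite /lower_siegel_mx mulmx0 -(@scalar_mx_block _ n n) mulmx1 //.
Qed.

End BigCell.

(** * Equivariance of the truncation map *)

Section Psi.
Variables (C : fieldType) (n : nat) (n_gt1 : (1 < n)%N).
Implicit Types g h u : Sp C n.

Lemma mul_block_inclE k N o m (B : 'M[C]_(m, N)) i (b : 'I_k)
    (lt : (o + b < N)%N) :
  (B *m block_incl C k N o) i b = B i (Ordinal lt).
Proof.
rewrite mxE (bigD1 (Ordinal lt)) //= mxE eqxx mulr1 big1 ?addr0 // => c cN.
rewrite mxE; case: eqP => [E|]; last by rewrite mulr0.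
by case/eqP: cN; apply: val_inj.
Qed.

Let V : 'M[C]_(n + n, n.+1) := block_incl C n.+1 (n + n) 0.

Lemma psiE g : psi n_gt1 g = usubmx (val g) *m V.
Proof.
apply/matrixP => i j; have lt : (0 + j < n + n)%N by have := ltn_ord j; lia.
rewrite (mul_block_inclE _ _ lt) !mxE; congr (val g _ _); exact: val_inj.
Qed.

Lemma psi_principal_cols g : psi n_gt1 g *m principal_cols C n = ulsubmx (val g).
Proof.
apply/matrixP => i j; have lt : (0 + j < n.+1)%N by have := ltn_ord j; lia.
rewrite (mul_block_inclE _ _ lt) !mxE; congr (val g _ _); exact: val_inj.
Qed.

Lemma psi_mulr g u (a : 'M[C]_n.+1) :
  val u *m V = V *m a -> psi n_gt1 (g * u)%g = psi n_gt1 g *m a.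
Proof. by move=> uV; rewrite !psiE Sp_valM -mul_usub_mx -!mulmxA uV. Qed.

Lemma psi_mull g u (a : 'M[C]_n) :
  usubmx (val u) = row_mx a 0 -> psi n_gt1 (u * g)%g = a *m psi n_gt1 g.
Proof.
move=> ua; rewrite !psiE Sp_valM -mul_usub_mx ua -{1}[val g]vsubmxK.
by rewrite mul_row_col mul0mx addr0 mulmxA.
Qed.

Lemma psi_SL2 g (h : SL2 C) :
  psi n_gt1 (g * SL2_Sp n h)%g = psi n_gt1 g *m SL2_GL n h.
Proof.
apply: psi_mulr; rewrite /= /SL2_GL !diag_blockE.
have VP : V *m block_incl C 2 n.+1 n.-1 = block_incl C 2 (n + n) n.-1.
  apply/matrixP => i a; have lt : (n.-1 + a < n.+1)%N by have := ltn_ord a; lia.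
  by rewrite (mul_block_inclE _ _ lt) !mxE.
have VTP : V^T *m block_incl C 2 (n + n) n.-1 = block_incl C 2 n.+1 n.-1.
  by rewrite -VP mulmxA block_inclTK ?mul1mx //; lia.
rewrite mulmxDl mulmxDr mul1mx mulmx1; congr (_ + _).
by rewrite !mulmxA VP -!mulmxA; congr (_ *m (_ *m _)); rewrite -VTP trmx_mul trmxK.
Qed.

Lemma lower_usubmx u : is_trig_mx (val u) ->
  usubmx (val u) = row_mx (ulsubmx (val u)) 0.
Proof. by move=> ut; rewrite -[LHS]hsubmxK -/(ursubmx _) ursubmx_trig. Qed.

Definition Sp_pred_block u : 'M[C]_n.-1 :=
  \matrix_(i, j) val u (widen_ord (leq_pred_double n) i)
                       (widen_ord (leq_pred_double n) j).

(** Such a u is upper triangular and fixes e_n and e_-n, which are the basis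
    vectors number n and n + 1; so it preserves the span of the first n + 1
    basis vectors and acts on it through its principal block. *)
Lemma Sp_pred_cols u : Sp_pred u -> is_trig_mx (val u)^T ->
  val u *m V = V *m diag_block n.+1 0 (Sp_pred_block u).
Proof.
move=> /forallP up /is_trig_mxP ut; have lt0 : (n.-1 < n)%N by lia.
have := up (Ordinal lt0); rewrite eqxx => /andP[/eqP epos /eqP eneg].
have u0 (i j : 'I_(n + n)) : (j < i)%N -> val u i j = 0.
  by move=> ji; have := ut j i ji; rewrite mxE.
have un (i j : 'I_(n + n)) : (j == n.-1 :> nat) || (j == n :> nat) ->
    val u i j = (i == j)%:R.
  case/orP => /eqP jE.
    have -> : j = lshift n (Ordinal lt0) by apply: val_inj.
    have := congr1 (fun M : 'cV_(n + n) => M i 0) epos.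
    by rewrite /e_pos -colE !mxE andbT.
  have -> : j = rev_ord (lshift n (Ordinal lt0)).
    by apply: val_inj; rewrite /= jE; lia.
  have := congr1 (fun M : 'cV_(n + n) => M i 0) eneg.
  by rewrite /e_neg -colE !mxE andbT.
apply/matrixP => i j; have lt : (0 + j < n + n)%N by have := ltn_ord j; lia.
rewrite (mul_block_inclE _ _ lt); have jn := ltn_ord j.
have [iN|iN] := ltnP i n.+1; last first.
  rewrite u0 /=; last by lia.
  rewrite mxE big1 // => k _; rewrite !mxE ltn_eqF ?mul0r //.
  by have := ltn_ord k; lia.
rewrite [RHS]mxE (bigD1 (Ordinal iN)) //= big1 => [|k ki]; last first.
  rewrite mxE (_ : (_ == _) = false) ?mul0r //.
  by apply: contra_neqF ki => /eqP ki; apply: val_inj; rewrite /= -ki.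
rewrite addr0 !mxE /= eqxx mul1r.
case: (pick_block n.-1 0 j) => [[b bj ->]|[jN ->]].
  case: (pick_block n.-1 0 i) => [[a ai ->]|[iN' ->]].
    by rewrite mxE; congr (val u _ _); apply: val_inj; rewrite /= -?ai -?bj.
  have ni : (n.-1 <= i)%N.
    rewrite leqNgt; apply/negP => lti.
    by have := iN' (Ordinal lti); rewrite /= eqxx.
  have bn := ltn_ord b; rewrite -val_eqE /= u0 /=; last by lia.
  by rewrite (_ : (_ == _) = false) //; lia.
have nj : (n.-1 <= j)%N.
  by rewrite leqNgt; apply/negP => lti; have := jN (Ordinal lti); rewrite /= eqxx.
rewrite un /=; last by lia.
rewrite -!val_eqE /=; case: pickP => [a _|] //.
Qed.

Lemma psi_Sp_pred g u : Sp_pred u -> is_trig_mx (val u)^T ->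
  psi n_gt1 (g * u)%g = psi n_gt1 g *m diag_block n.+1 0 (Sp_pred_block u).
Proof. by move=> up ut; apply/psi_mulr/Sp_pred_cols. Qed.

End Psi.

(** * A section of the truncation map over the big cell *)

Section BigCellSection.
Variables (C : fieldType) (n : nat) (n_gt1 : (1 < n)%N).
Local Notation s := (antidiag C n).

Let last_lt : (n.-1 < n)%N. Proof. by rewrite prednK // ltnW. Qed.
Let last : 'I_n := Ordinal last_lt.
Let e : 'cV[C]_n := delta_mx last 0.

(** Among the symmetric matrices with last column y, one that is linear in y;
    any other choice with polynomial entries would do. *)
Definition sym_with_last_col (y : 'cV[C]_n) : 'M[C]_n :=
  y *m e^T + e *m y^T - y last 0 *: (e *m e^T).

Lemma sym_with_last_colT y : (sym_with_last_col y)^T = sym_with_last_col y.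
Proof.
rewrite /sym_with_last_col linearB linearD linearZ /= !trmx_mul !trmxK.
by rewrite [_ + y *m _]addrC.
Qed.

Lemma sym_with_last_colE y : sym_with_last_col y *m e = y.
Proof.
have ee : e^T *m e = 1%:M.
  by rewrite trmx_delta mul_delta_mx; apply/matrixP => i j; rewrite !ord1 !mxE.
have ye : y^T *m e = (y last 0)%:M.
  by rewrite -colE; apply/matrixP => i j; rewrite !ord1 !mxE mulr1n.
rewrite mulmxBl mulmxDl -scalemxAl -!mulmxA ee ye !mulmx1.
by rewrite mul_mx_scalar addrK.
Qed.

Definition frame (x : 'M[C]_(n, n.+1)) : 'M[C]_n := x *m principal_cols C n.

Definition cell_sym (x : 'M[C]_(n, n.+1)) : 'M[C]_n :=
  sym_with_last_col (invmx (frame x) *m col ord_max x).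

(** A symplectic matrix whose entries are polynomials in those of x and of the
    inverse of its frame, and which psi maps to x. *)
Definition cell_section (x : 'M[C]_(n, n.+1)) : Sp C n :=
  (levi (frame x) * upper_siegel (cell_sym x))%g.

Lemma mul_levi_siegel a Y : a \in unitmx -> Y^T = Y ->
  val (levi a * upper_siegel Y)%g =
  block_mx a (a *m Y *m s) 0 (s *m (invmx a)^T *m s).
Proof.
move=> aU YT; rewrite Sp_valM val_levi // val_upper_siegel //.
rewrite mulmx_block !mulmx0 !mul0mx !mulmx1 !addr0 !add0r.
by rewrite mulmxA.
Qed.

Lemma first_col_antidiag (a : 'M[C]_n) i (j : 'I_n) : j = 0 :> nat ->
  (a *m s) i j = (a *m e) i 0.
Proof.
move=> j0; rewrite mul_antidiagE -colE mxE; congr (a i _).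
by apply: val_inj; rewrite /= j0; lia.
Qed.

Lemma psi_cell_section x : frame x \in unitmx -> psi n_gt1 (cell_section x) = x.
Proof.
move=> xU; have n0 : (0 < n)%N by lia.
apply/matrixP => i j; rewrite mxE mul_levi_siegel ?sym_with_last_colT //.
have [jn|nj] := ltnP j n.
  have -> : widen_ord (psi_leq n_gt1) j = lshift n (Ordinal jn) by apply: val_inj.
  have lt : (0 + Ordinal jn < n.+1)%N by rewrite /=; lia.
  rewrite block_mxEul /frame (mul_block_inclE _ _ lt).
  by congr (x i _); apply: val_inj.
have jE : j = n :> nat by have := ltn_ord j; lia.
have -> : widen_ord (psi_leq n_gt1) j = rshift n (Ordinal n0).
  by apply: val_inj; rewrite /= addn0.
rewrite block_mxEur first_col_antidiag // -mulmxA sym_with_last_colE mulKVmx //.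
by rewrite mxE; congr (x i _); apply: val_inj.
Qed.

(** Since Y is symmetric, the vanishing of its last column means that the
    unipotent matrix fixes e_n and e_-n. *)
Lemma upper_siegel_U_C_pred Y : Y^T = Y -> Y *m e = 0 ->
  upper_siegel Y \in @U_C_pred C n.
Proof.
move=> YT Ye; rewrite /U_C_pred unfold_in; apply/andP; split.
  apply/forallP => i; apply/implyP => /eqP iE.
  have -> : i = last by apply: val_inj.
  apply/andP; split; apply/eqP; rewrite val_upper_siegel // ?e_posE ?e_negE.
    by rewrite mul_block_col mul1mx mulmx0 mul0mx addr0 mulmx0 addr0.
  rewrite mul_block_col !mulmx0 mul1mx !add0r -mulmxA [s *m (s *m e)]mulmxA.
  by rewrite antidiagK mul1mx Ye.
rewrite val_upper_siegel // /upper_unip /lower_unip tr_block_mx trmx0 !trmx1.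
rewrite is_trig_block_mx // eqxx !scalar_mx_is_trig /=.
by apply/forallP => i; case: (split_ordP i) => j ->;
  rewrite ?block_mxEul ?block_mxEdr mxE eqxx.
Qed.

(** The rows [A, B] of g are those of the product of the Levi element of A with
    the unipotent element of Z = A^-1 B s, which is symmetric by isotropy, and Z
    differs from the symmetric matrix used in the section by a matrix with
    zero last column: the latter is absorbed by the right invariance. *)
Lemma BSp_cell_section (f : BSp C n) (g : Sp C n) :
  ulsubmx (val g) \in unitmx -> val f g = val f (cell_section (psi n_gt1 g)).
Proof.
have /asboolP[_ fi] := valP f => gU.
have one_U : (1%g : Sp C n) \in @U_C_pred C n.
  have -> : 1%g = upper_siegel 0 :> Sp C n.
    apply: val_inj; rewrite val_upper_siegel ?trmx0 //.
    by rewrite /upper_siegel_mx mul0mx -(@scalar_mx_block _ n n).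
  by apply: upper_siegel_U_C_pred; rewrite ?trmx0 ?mul0mx.
have one_Ubar : (1%g : Sp C n) \in @Ubar_C C n.
  by rewrite -(mulgV g); apply: usubmx_eq_Ubar.
have fl h k : usubmx (val h) = usubmx (val k) -> val f h = val f k.
  move/usubmx_eq_Ubar => hk.
  by rewrite -(fi _ _ k hk one_U) mulg1 -mulgA mulVg mulg1.
set A := ulsubmx (val g) in gU; set B := ursubmx (val g).
pose Z := invmx A *m B *m s.
have ZT : Z^T = Z.
  apply: (can_inj (mulKmx gU)).
  have AU : A^T \in unitmx by rewrite unitmx_tr.
  apply: (can_inj (mulmxK AU)).
  have AZ : A *m Z = B *m s by rewrite /Z -mulmxA mulKVmx.
  rewrite AZ -mulmxA -trmx_mul AZ trmx_mul tr_antidiag mulmxA.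
  exact: symplectic_isotropic.
(* As B = A Z s, the vector A^-1 b is the first column of Z s, which is the last
   column of Z. *)
set x := psi n_gt1 g.
have xA : frame x = A by apply: psi_principal_cols.
have xb : invmx (frame x) *m col ord_max x = Z *m e.
  rewrite xA /Z -!mulmxA; congr (_ *m _); apply/matrixP => i k; rewrite ord1.
  have n0 : (0 < n)%N by lia.
  rewrite mulmxA -(first_col_antidiag _ _ (j := Ordinal n0)) //.
  rewrite -mulmxA antidiagK mulmx1 !mxE; congr (val g _ _); apply: val_inj => /=.
  by rewrite addn0.
have WT : (Z - cell_sym x)^T = Z - cell_sym x.
  by rewrite linearB /= ZT sym_with_last_colT.
have We : (Z - cell_sym x) *m e = 0.
  by rewrite mulmxBl /cell_sym sym_with_last_colE xb subrr.
rewrite (fl g (1 * cell_section x * upper_siegel (Z - cell_sym x))%g).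
  by apply: fi => //; apply: upper_siegel_U_C_pred.
rewrite mul1g Sp_valM mul_levi_siegel ?xA ?sym_with_last_colT //.
rewrite val_upper_siegel //.
rewrite -[val g]submxK -/A -/B mulmx_block !block_mxEv !col_mxKu.
rewrite mulmx0 mulmx1 addr0 mulmx1 !mulmxA -mulmxDl -mulmxDr subrK; congr row_mx.
by rewrite /Z !mulmxA mulmxV // mul1mx -mulmxA antidiagK mulmx1.
Qed.

End BigCellSection.

(** * Functions that are polynomial up to powers of a denominator *)

Section Localization.
Variables (C : fieldType) (p q : nat) (D0 : {mpoly C[p * q]}).
Local Notation D x := (ev x D0).
Implicit Types (f g : 'M[C]_(p, q) -> C).

(** The values of f where the denominator vanishes are left free: there [invmx] is
    a total function without algebraic meaning. *)
Definition localized f : Prop :=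
  exists k, exists P : {mpoly C[p * q]},
    forall x, D x != 0 -> f x * D x ^+ k = ev x P.

Lemma localized_eq f g :
  (forall x, D x != 0 -> f x = g x) -> localized g -> localized f.
Proof. by move=> fg [k [P gP]]; exists k, P => x Dx; rewrite fg // gP. Qed.

Lemma localized_const c : localized (fun=> c).
Proof. by exists 0, c%:MP => x _; rewrite mulr1 mevalC. Qed.

Lemma localized_coord i j : localized (fun x => x i j).
Proof. by exists 0, 'X_(mxvec_index i j) => x _; rewrite mulr1 mevalXU mxvecE. Qed.

Lemma localized_inv : localized (fun x => (D x)^-1).
Proof. by exists 1, 1 => x Dx; rewrite expr1 mulVf // meval1. Qed.

Lemma localizedD f g :
  localized f -> localized g -> localized (fun x => f x + g x).
Proof.
move=> [k [P fP]] [l [Q gQ]]; exists (k + l)%N, (P * D0 ^+ l + Q * D0 ^+ k) => x Dx.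
by rewrite mevalD !mevalM !rmorphXn /= -fP // -gQ // exprD; ring.
Qed.

Lemma localizedM f g :
  localized f -> localized g -> localized (fun x => f x * g x).
Proof.
move=> [k [P fP]] [l [Q gQ]]; exists (k + l)%N, (P * Q) => x Dx.
by rewrite mevalM -fP // -gQ // exprD; ring.
Qed.

Lemma localized_sum I (r : seq I) (F : I -> 'M[C]_(p, q) -> C) :
  (forall i, localized (F i)) -> localized (fun x => \sum_(i <- r) F i x).
Proof.
move=> FL; elim: r => [|i r IH].
  by apply: localized_eq (localized_const 0) => x _; rewrite big_nil.
by apply: localized_eq (localizedD (FL i) IH) => x _; rewrite big_cons.
Qed.

Lemma localized_prod I (r : seq I) (F : I -> 'M[C]_(p, q) -> C) :
  (forall i, localized (F i)) -> localized (fun x => \prod_(i <- r) F i x).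
Proof.
move=> FL; elim: r => [|i r IH].
  by apply: localized_eq (localized_const 1) => x _; rewrite big_nil.
by apply: localized_eq (localizedM (FL i) IH) => x _; rewrite big_cons.
Qed.

Lemma localizedX f k : localized f -> localized (fun x => f x ^+ k).
Proof.
move=> fL; elim: k => [|k IH]; first exact: localized_const 1.
by apply: localized_eq (localizedM fL IH) => x _; rewrite exprS.
Qed.

Lemma localized_meval N (P : {mpoly C[N]}) (F : 'I_N -> 'M[C]_(p, q) -> C) :
  (forall i, localized (F i)) -> localized (fun x => P.@[fun i => F i x]).
Proof.
move=> FL; under eq_fun do rewrite mevalE.
apply: localized_sum => m; apply: localizedM (localized_const _) _.
by apply: localized_prod => i; apply: localizedX.
Qed.

Definition localized_mx m n (F : 'M[C]_(p, q) -> 'M[C]_(m, n)) : Prop :=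
  forall i j, localized (fun x => F x i j).

Lemma localized_mx_eq m n (F G : 'M[C]_(p, q) -> 'M[C]_(m, n)) :
  (forall x, D x != 0 -> F x = G x) -> localized_mx G -> localized_mx F.
Proof. by move=> FG GL i j; apply: localized_eq (GL i j) => x /FG ->. Qed.

Lemma localized_mx_const m n (A : 'M[C]_(m, n)) : localized_mx (fun=> A).
Proof. by move=> i j; apply: localized_const. Qed.

Lemma localized_mx_id : localized_mx id.
Proof. exact: localized_coord. Qed.

Lemma localized_mxD m n (F G : 'M[C]_(p, q) -> 'M[C]_(m, n)) :
  localized_mx F -> localized_mx G -> localized_mx (fun x => F x + G x).
Proof.
move=> FL GL i j.
by apply: localized_eq (localizedD (FL i j) (GL i j)) => x _; rewrite mxE.
Qed.

Lemma localized_mxZ m n f (F : 'M[C]_(p, q) -> 'M[C]_(m, n)) :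
  localized f -> localized_mx F -> localized_mx (fun x => f x *: F x).
Proof.
move=> fL FL i j.
by apply: localized_eq (localizedM fL (FL i j)) => x _; rewrite mxE.
Qed.

Lemma localized_mulmx m n r (F : 'M[C]_(p, q) -> 'M[C]_(m, n))
    (G : 'M[C]_(p, q) -> 'M[C]_(n, r)) :
  localized_mx F -> localized_mx G -> localized_mx (fun x => F x *m G x).
Proof.
move=> FL GL i j.
apply: (@localized_eq _ (fun x => \sum_k F x i k * G x k j)).
  by move=> x _; rewrite mxE.
by apply: localized_sum => k; apply: localizedM.
Qed.

Lemma localized_trmx m n (F : 'M[C]_(p, q) -> 'M[C]_(m, n)) :
  localized_mx F -> localized_mx (fun x => (F x)^T).
Proof. by move=> FL i j; apply: localized_eq (FL j i) => x _; rewrite mxE. Qed.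

Lemma localized_block_mx m1 m2 n1 n2
    (F11 : 'M[C]_(p, q) -> 'M[C]_(m1, n1)) (F12 : 'M[C]_(p, q) -> 'M[C]_(m1, n2))
    (F21 : 'M[C]_(p, q) -> 'M[C]_(m2, n1)) (F22 : 'M[C]_(p, q) -> 'M[C]_(m2, n2)) :
  localized_mx F11 -> localized_mx F12 -> localized_mx F21 -> localized_mx F22 ->
  localized_mx (fun x => block_mx (F11 x) (F12 x) (F21 x) (F22 x)).
Proof.
move=> L11 L12 L21 L22 i j.
case: (split_ordP i) => i' ->; case: (split_ordP j) => j' ->.
- by apply: localized_eq (L11 i' j') => x _; rewrite block_mxEul.
- by apply: localized_eq (L12 i' j') => x _; rewrite block_mxEur.
- by apply: localized_eq (L21 i' j') => x _; rewrite block_mxEdl.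
- by apply: localized_eq (L22 i' j') => x _; rewrite block_mxEdr.
Qed.

Lemma localized_det n (F : 'M[C]_(p, q) -> 'M[C]_n) :
  localized_mx F -> localized (fun x => \det (F x)).
Proof.
move=> FL; apply: localized_sum => t.
by apply: localizedM (localized_const _) _; apply: localized_prod => i.
Qed.

Lemma localized_invmx n (F : 'M[C]_(p, q) -> 'M[C]_n) :
  (forall x, \det (F x) = D x) -> localized_mx F ->
  localized_mx (fun x => invmx (F x)).
Proof.
move=> FD FL; apply: (@localized_mx_eq _ _ _ (fun x => (D x)^-1 *: \adj (F x))).
  by move=> x Dx; rewrite /invmx unitmxE unitfE FD Dx.
apply: localized_mxZ localized_inv _ => i j.
apply: (@localized_eq _ (fun x => cofactor (F x) j i)) => [x _|].
  by rewrite mxE.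
apply: localizedM (localized_const _) (localized_det _) => k l.
by apply: localized_eq (FL (lift j k) (lift i l)) => x _; rewrite !mxE.
Qed.

End Localization.

(** * Invariant functions are polynomials in the truncation *)

Section DiagBlock.
Variables (C : fieldType) (k N o : nat).
Hypothesis le_okN : (o + k <= N)%N.
Implicit Types A B : 'M[C]_k.

Lemma diag_block1 : diag_block N o (1%:M : 'M[C]_k) = 1%:M.
Proof. by rewrite diag_blockE subrr mulmx0 mul0mx addr0. Qed.

Lemma diag_block_mul A B :
  diag_block N o A *m diag_block N o B = diag_block N o (A *m B).
Proof.
rewrite !diag_blockE; set P := block_incl _ _ _ _.
have PK : P^T *m P = 1%:M by apply: block_inclTK.
have -> : A *m B - 1%:M = (A - 1%:M) + (B - 1%:M) + (A - 1%:M) *m (B - 1%:M).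
  rewrite mulmxBl mul1mx mulmxBr mulmx1.
  set AB := A *m B; apply/matrixP => i j; rewrite !mxE; ring.
set X := A - _; set Y := B - _; clearbody X Y.
have -> : P *m (X + Y + X *m Y) *m P^T =
    P *m X *m P^T + P *m Y *m P^T + P *m X *m P^T *m (P *m Y *m P^T).
  rewrite !mulmxDr !mulmxDl; congr (_ + _).
  by rewrite !mulmxA -[_ *m P^T *m P]mulmxA PK mulmx1.
rewrite mulmxDl mul1mx mulmxDr mulmx1 !addrA; congr (_ + _); exact: addrAC.
Qed.

Lemma diag_block_unit A : A \in unitmx -> diag_block N o A \in unitmx.
Proof.
move=> AU; have : diag_block N o A *m diag_block N o (invmx A) = 1%:M.
  by rewrite diag_block_mul mulmxV // diag_block1.
by case/mulmx1_unit.
Qed.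

Lemma tr_diag_block A : (diag_block N o A)^T = diag_block N o A^T.
Proof.
by rewrite !diag_blockE linearD /= !trmx_mul trmxK trmx1 linearB /= trmx1 mulmxA.
Qed.

End DiagBlock.

Section PolynomialExtension.
Variables (C : numFieldType) (n : nat) (n_gt1 : (1 < n)%N).
Local Notation s := (antidiag C n).

(** Affine space is irreducible. *)
Lemma mpoly_dense p q (D P Q : {mpoly C[p * q]}) (x0 : 'M[C]_(p, q)) :
  ev x0 D != 0 -> (forall x : 'M[C]_(p, q), ev x D != 0 -> ev x P = ev x Q) ->
  P = Q.
Proof.
move=> Dx0 PQ; have : (P - Q) * D = 0.
  apply: mpoly_eq0 => v.
  have vE : v =1 (fun k => mxvec (vec_mx (\row_k v k) : 'M[C]_(p, q)) 0 k).
    by move=> i; rewrite vec_mxK mxE.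
  rewrite (meval_eq _ vE) mevalM mevalB; set x := vec_mx _.
  have [->|Dx] := eqVneq (ev x D) 0; first by rewrite mulr0.
  by rewrite PQ // subrr mul0r.
move/eqP; rewrite mulf_eq0 => /orP[|/eqP D0]; first by rewrite subr_eq0 => /eqP.
by rewrite D0 meval0 eqxx in Dx0.
Qed.

Lemma mpoly_linear p q p' q' (L : {linear 'M[C]_(p, q) -> 'M[C]_(p', q')})
    (P : {mpoly C[p' * q']}) :
  exists Q : {mpoly C[p * q]}, forall x, ev (L x) P = ev x Q.
Proof.
exists (P \mPo [tuple \sum_i lin_mx L i k *: 'X_i | k < p' * q']) => x.
rewrite comp_mpoly_meval; apply: meval_eq => k.
rewrite tnth_mktuple -mul_vec_lin mxE raddf_sum.
by apply: eq_bigr => i _ /=; rewrite mevalZ mevalXU mulrC.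
Qed.

Lemma frame_unit x : (frame x \in unitmx) = (\det (frame x : 'M[C]_n) != 0).
Proof. by rewrite unitmxE unitfE. Qed.

Lemma frame_dense (P Q : {mpoly C[n * n.+1]}) :
  (forall x, frame x \in unitmx -> ev x P = ev x Q) -> P = Q.
Proof.
move=> PQ; apply: (@mpoly_dense _ _ (generic_minor (principal_cols C n)) P Q
  (principal_cols C n)^T).
  by rewrite meval_generic_minor principal_colsTK det1 oner_neq0.
by move=> x; rewrite meval_generic_minor -frame_unit; apply: PQ.
Qed.

Lemma BSp_section_localized (f : BSp C n) :
  exists k, exists P : {mpoly C[n * n.+1]}, forall x, frame x \in unitmx ->
    val f (cell_section n_gt1 x) * \det (frame x) ^+ k = ev x P.
Proof.
have /asboolP[[P fP] _] := valP f.
pose D0 := generic_minor (principal_cols C n).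
have D0E x : ev x D0 = \det (frame x) by rewrite meval_generic_minor.
pose loc := localized D0.
suff [k [Q H]] : loc (fun x => val f (cell_section n_gt1 x)).
  by exists k, Q => x; rewrite frame_unit -D0E; apply: H.
pose sec x : 'M[C]_(n + n) :=
  block_mx (frame x) (frame x *m cell_sym n_gt1 x *m s) 0
           (s *m (invmx (frame x))^T *m s).
apply: (@localized_eq _ _ _ _ _ (fun x => P.@[fun k => mxvec (sec x) 0 k])).
  move=> x; rewrite D0E -frame_unit => xU; rewrite fP; apply: meval_eq => k.
  by rewrite mul_levi_siegel // sym_with_last_colT.
apply: localized_meval => k; case/mxvec_indexP: k => i j.
have cst m r (A : 'M[C]_(m, r)) : localized_mx D0 (fun=> A).
  exact: localized_mx_const.
have frameL : localized_mx D0 (@frame C n).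
  exact: localized_mulmx (@localized_mx_id _ _ _ _) (cst _ _ _).
have invL : localized_mx D0 (fun x => invmx (frame x)).
  by apply: localized_invmx => // x; rewrite D0E.
have colL : localized_mx D0 (fun x => invmx (frame x) *m col ord_max x).
  apply: localized_mulmx => // a b.
  apply: localized_eq (localized_coord _ a ord_max) => x _; exact: mxE.
have symL : localized_mx D0 (cell_sym n_gt1).
  apply: localized_mxD.
    apply: localized_mxD; apply: localized_mulmx => //.
    exact: localized_trmx.
  apply: (@localized_mx_eq _ _ _ _ _ _ _ (fun x => _ *: _)) => [x _|].
    by rewrite -scaleNr.
  apply: localized_mxZ => //.
  apply: (@localized_eq _ _ _ _ _ (fun x => -1 * _)) => [x _|].
    by rewrite mulN1r.
  by apply: localizedM (localized_const _ _) (colL _ _).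
have secL : localized_mx D0 sec.
  apply: localized_block_mx => //.
    by do 2!apply: localized_mulmx => //.
  by do 2!apply: localized_mulmx => //; apply: localized_trmx.
by apply: localized_eq (secL i j) => x _; rewrite mxvecE.
Qed.

(** Let f' be the translate of f by the shear H, so that f' (section x) is
    f (section (x H)).  Applying [BSp_section_localized] to f' makes this function
    a polynomial over a power of det (frame x), and applying it to f makes it a
    polynomial over a power of det (frame (x H)).  Since these denominators are
    coprime, the first one divides its numerator. *)
Lemma sheared_extension (f : BSp C n) :
  exists F : {mpoly C[n * n.+1]}, forall x, frame x \in unitmx ->
    val f (cell_section n_gt1 x * SL2_Sp n (shear C))%g = ev x F.
Proof.
have n_gt0 := ltnW n_gt1.
have [k [P fP]] := BSp_section_localized f.
have [l [Q fQ]] := BSp_section_localized (BSp_SL2 (shear C) f).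
pose H := SL2_GL n (shear C).
have [PH PHE] := mpoly_linear (mulmxr H) P.
pose S := principal_cols C n.
have shift_f x : frame x \in unitmx -> frame (x *m H) \in unitmx ->
    val f (cell_section n_gt1 x * SL2_Sp n (shear C))%g =
    val f (cell_section n_gt1 (x *m H)).
  move=> xU xHU; rewrite [LHS](BSp_cell_section n_gt1).
    by rewrite psi_SL2 psi_cell_section.
  by rewrite -(psi_principal_cols n_gt1) psi_SL2 psi_cell_section.
have PQ : generic_minor (H *m S) ^+ k * Q = generic_minor S ^+ l * PH.
  have [i0 i0E HS] := shear_principal_cols C n_gt0.
  pose D := generic_minor (H *m S) * generic_minor S.
  have DE x : ev x D = \det (x *m (H *m S)) * \det (x *m S).
    rewrite /D mevalM; congr (_ * _); exact: meval_generic_minor.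
  apply: (@mpoly_dense _ _ D _ _ S^T).
    rewrite DE principal_colsTK det1 mulr1 HS.
    by rewrite mulmxDr principal_colsTK principal_colsT_delta addr0 det1 oner_neq0.
  move=> x; rewrite DE mulf_eq0 negb_or mulmxA => /andP[xHU xU].
  apply: etrans (meval_generic_minorXM _ _ _ _) _.
  apply: etrans _ (esym (meval_generic_minorXM _ _ _ _)).
  rewrite mulmxA -PHE -(fQ x) ?frame_unit // -(fP (x *m H)) ?frame_unit //.
  by rewrite -shift_f ?frame_unit //= /frame; ring.
have [F FE] : exists F : {mpoly C[n * n.+1]}, forall x : 'M[C]_(n, n.+1),
    ev x Q = \det (x *m S) ^+ l * ev x F.
  apply: (@sheared_minor_division C n n_gt0 Q PH l k) => x.
  have := congr1 (meval (fun k => mxvec x 0 k)) PQ.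
  rewrite (meval_generic_minorXM (H *m S)) mulmxA => ->.
  exact: (meval_generic_minorXM S).
exists F => x xU; have dx : \det (frame x) ^+ l != 0.
  by rewrite expf_neq0 // -frame_unit.
apply: (mulIf dx); rewrite [RHS]mulrC -[RHS]FE -(fQ x xU) //.
Qed.

(** The polynomial found for the translate of f by the shear is valid on all of
    Sp_2n by density, and is translated back. *)
Lemma BSp_extension (f : BSp C n) :
  exists F : {mpoly C[n * n.+1]}, forall g, val f g = ev (psi n_gt1 g) F.
Proof.
have [F FE] := sheared_extension f.
pose sig := SL2_Sp n (shear C); pose H := SL2_GL n (shear C).
have HU : H \in unitmx.
  apply: diag_block_unit; first by lia.
  by rewrite unitmxE (eqP (valP (shear C))) unitr1.
have [FH FHE] := mpoly_linear (mulmxr (invmx H)) F.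
exists FH.
pose psi_lin (A : 'M[C]_(n + n)) := mxsub (lshift n) (widen_ord (psi_leq n_gt1)) A.
have [G GE] := mpoly_linear psi_lin F.
have shifted g : val f (g * sig)%g = ev (psi n_gt1 g) F.
  have /asboolP[fr _] := valP (BSp_SL2 (shear C) f).
  have dr : regular_function (fun g : Sp C n => val g)
      (fun g => val f (g * sig)%g - ev (psi n_gt1 g) F).
    have [P fP] := fr; exists (P - G) => h.
    by rewrite mevalB -fP -GE.
  apply/eqP; rewrite -subr_eq0; apply/eqP.
  apply: (Sp_big_cell_dense dr) => h hU.
  have hfr : frame (psi n_gt1 h) \in unitmx by rewrite /frame psi_principal_cols.
  rewrite -(FE _ hfr); apply/eqP; rewrite subr_eq0; apply/eqP.
  exact: (BSp_cell_section n_gt1 (BSp_SL2 (shear C) f) hU).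
move=> g; have gE : (g * sig^-1 * sig)%g = g by rewrite -mulgA mulVg mulg1.
have psi_g : psi n_gt1 (g * sig^-1)%g = psi n_gt1 g *m invmx H.
  by rewrite -[in RHS]gE psi_SL2 mulmxK.
by rewrite -[in LHS]gE shifted psi_g FHE.
Qed.

End PolynomialExtension.

(** * Lifting the triangular groups to the symplectic group *)

Section TriangularBlocks.
Variables (C : fieldType).

Lemma torusP k (A : 'M[C]_k) :
  torus A <-> is_diag_mx A /\ forall i, A i i != 0.
Proof.
have unitE : is_diag_mx A -> (A \in unitmx) = [forall i, A i i != 0].
  move=> Ad; rewrite unitmxE det_trig ?is_diag_mx_is_trig // unitfE.
  apply/prodf_neq0/forallP => [H i|H i _]; exact: H.
rewrite /torus; split=> [/andP[Ad]|[Ad]]; rewrite ?Ad ?unitE //.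
  by move/forallP.
by move=> H; apply/forallP.
Qed.

Lemma lower_unip_unit k (A : 'M[C]_k) : lower_unip A -> A \in unitmx.
Proof.
move=> /andP[At /forallP A1]; rewrite unitmxE det_trig // big1 ?unitr1 // => i _.
exact/eqP.
Qed.

Lemma upper_unip_unit k (A : 'M[C]_k) : upper_unip A -> A \in unitmx.
Proof. by move/lower_unip_unit; rewrite unitmx_tr. Qed.

Lemma diag_block_trig k N o (A : 'M[C]_k) :
  is_trig_mx A -> is_trig_mx (diag_block N o A).
Proof.
move=> /is_trig_mxP At; apply/is_trig_mxP => i j ij; rewrite mxE -val_eqE ltn_eqF //.
case: (pick_block k o i) => [[a ai ->]|[_ ->]] //.
case: (pick_block k o j) => [[b bj ->]|[_ ->]] //.
by rewrite At //; move: ij; rewrite -ai -bj ltn_add2l.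
Qed.

Lemma diag_block_diag k N o (A : 'M[C]_k) i :
  diag_block N o A i i = 1 \/ exists a, diag_block N o A i i = A a a.
Proof.
rewrite mxE eqxx; case: (pick_block k o i) => [[a ai ->]|[_ ->]]; [right | by left].
by exists a.
Qed.

Lemma diag_block_lower_unip k N o (A : 'M[C]_k) :
  lower_unip A -> lower_unip (diag_block N o A).
Proof.
move=> /andP[At /forallP A1]; rewrite /lower_unip diag_block_trig //=.
apply/forallP => i; case: (diag_block_diag o A i) => [->|[a ->]] //.
Qed.

Lemma diag_block_upper_unip k N o (A : 'M[C]_k) :
  upper_unip A -> upper_unip (diag_block N o A).
Proof. by rewrite /upper_unip tr_diag_block; apply: diag_block_lower_unip. Qed.

Lemma diag_block_torus k N o (A : 'M[C]_k) :
  torus A -> torus (diag_block N o A).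
Proof.
move=> /torusP[]; rewrite is_diag_mxEtrig => /andP[Al Au] A0; apply/torusP.
rewrite is_diag_mxEtrig tr_diag_block !diag_block_trig //; split=> // i.
by case: (diag_block_diag o A i) => [->|[a ->]] //; apply: oner_neq0.
Qed.

End TriangularBlocks.

Section Lifts.
Variables (C : fieldType) (n : nat) (n_gt1 : (1 < n)%N).
Local Notation s := (antidiag C n).

Lemma psi_levi (a : 'M[C]_n) g : a \in unitmx ->
  psi n_gt1 (levi a * g)%g = a *m psi n_gt1 g.
Proof.
by move=> aU; apply: psi_mull; rewrite val_levi // /levi_mx block_mxEv col_mxKu.
Qed.

Definition levi_pred (b : 'M[C]_n.-1) : Sp C n := levi (diag_block n 0 b).

Lemma diag_block_pred_unit (b : 'M[C]_n.-1) :
  b \in unitmx -> diag_block n 0 b \in unitmx.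
Proof. by move=> bU; apply: diag_block_unit => //; rewrite add0n leq_pred. Qed.

(** [diag_block n 0 b] and the transpose of its inverse both fix the last basis
    vector. *)
Lemma Sp_pred_levi (b : 'M[C]_n.-1) : b \in unitmx -> Sp_pred (levi_pred b).
Proof.
move=> bU; have bbU := diag_block_pred_unit bU.
apply/forallP => i; apply/implyP => /eqP iE.
pose e : 'cV[C]_n := delta_mx i 0.
have fix_e (b' : 'M[C]_n.-1) : diag_block n 0 b' *m e = e.
  rewrite diag_blockE mulmxDl mul1mx -!mulmxA.
  rewrite (_ : _^T *m e = 0) ?mulmx0 ?addr0 //.
  apply/matrixP => j k; rewrite mxE big1 ?mxE // => l _; rewrite !mxE -!val_eqE /= iE.
  case: eqP => [<-|]; rewrite ?mul0r //.
  by rewrite [_ == n.-1]ltn_eqF ?mulr0 // add0n.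
have fix_inv : (invmx (diag_block n 0 b))^T *m e = e.
  rewrite trmx_inv tr_diag_block -{1}(fix_e b^T) mulKmx //.
  by rewrite diag_block_pred_unit // unitmx_tr.
rewrite /fixes_pair val_levi // e_posE e_negE -/e /levi_mx !mul_block_col.
rewrite !mulmx0 !mul0mx !addr0 !add0r fix_e eqxx /=.
by rewrite -!mulmxA [s *m (s *m e)]mulmxA antidiagK mul1mx fix_inv.
Qed.

Lemma Sp_pred_block_levi (b : 'M[C]_n.-1) : b \in unitmx ->
  Sp_pred_block (levi_pred b) = b.
Proof.
move=> bU; have lt (i : 'I_n.-1) : (i < n)%N by have := ltn_ord i; lia.
have wE (i : 'I_n.-1) :
    widen_ord (leq_pred_double n) i = lshift n (Ordinal (lt i)).
  exact: val_inj.
apply/matrixP => i j; rewrite mxE !wE val_levi ?diag_block_pred_unit //.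
rewrite block_mxEul mxE.
case: (pick_block n.-1 0 (Ordinal (lt i))) => [[a ai ->]|[/(_ i)]]; last first.
  by rewrite /= eqxx.
case: (pick_block n.-1 0 (Ordinal (lt j))) => [[c cj ->]|[/(_ j)]]; last first.
  by rewrite /= eqxx.
by congr (b _ _); apply: val_inj.
Qed.

Lemma psi_levi_pred (b : 'M[C]_n.-1) g :
  b \in unitmx -> is_trig_mx b^T ->
  psi n_gt1 (g * levi_pred b)%g = psi n_gt1 g *m diag_block n.+1 0 b.
Proof.
move=> bU bt; rewrite psi_Sp_pred ?Sp_pred_block_levi ?Sp_pred_levi //.
rewrite val_levi ?diag_block_pred_unit // tr_levi_mx tr_diag_block.
have bbt := diag_block_trig n 0 bt; apply: levi_mx_trig => //.
have [|//] := trig_inv bbt (b := (invmx (diag_block n 0 b))^T).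
by rewrite -tr_diag_block -trmx_mul mulVmx ?trmx1 ?diag_block_pred_unit.
Qed.

Lemma psi_triangular (t u g : Sp C n) :
  is_trig_mx (val t) -> Sp_pred u -> is_trig_mx (val u)^T ->
  psi n_gt1 (t * g * u)%g =
  ulsubmx (val t) *m psi n_gt1 g *m diag_block n.+1 0 (Sp_pred_block u).
Proof.
move=> tt up ut; rewrite psi_Sp_pred //.
by rewrite (psi_mull n_gt1 g (lower_usubmx tt)).
Qed.

Lemma ulsubmx_lower_unip (A : 'M[C]_(n + n)) :
  lower_unip A -> lower_unip (ulsubmx A).
Proof.
move=> /andP[At /forallP A1]; rewrite /lower_unip ulsubmx_trig //=.
by apply/forallP => i; rewrite !mxE.
Qed.

Lemma ulsubmx_torus (A : 'M[C]_(n + n)) : torus A -> torus (ulsubmx A).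
Proof.
move=> /torusP[/is_diag_mxP Ad A0]; apply/torusP; split=> [|i]; rewrite ?mxE //.
by apply/is_diag_mxP => i j ij; rewrite !mxE Ad.
Qed.

Lemma Sp_pred_block_upper_unip (u : Sp C n) :
  upper_unip (val u) -> upper_unip (Sp_pred_block u).
Proof.
move=> /andP[/is_trig_mxP ut /forallP u1]; apply/andP; split.
  by apply/is_trig_mxP => i j ij; have := ut (widen_ord (leq_pred_double n) i)
    (widen_ord (leq_pred_double n) j) ij; rewrite !mxE.
by apply/forallP => i; have := u1 (widen_ord (leq_pred_double n) i); rewrite !mxE.
Qed.

Lemma Sp_pred_block_torus (u : Sp C n) :
  torus (val u) -> torus (Sp_pred_block u).
Proof.
move=> /torusP[/is_diag_mxP ud u0]; apply/torusP; split=> [|i]; rewrite ?mxE //.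
by apply/is_diag_mxP => i j ij; rewrite !mxE ud.
Qed.

End Lifts.

(** * The isomorphism *)

Section PsiStar.
Variables (C : numFieldType) (n : nat) (n_gt1 : (1 < n)%N).

Lemma psi_regular (P : {mpoly C[n * n.+1]}) :
  exists Q : {mpoly C[(n + n) * (n + n)]},
    forall g, ev (psi n_gt1 g) P = ev (val g) Q.
Proof.
have [Q QE] := mpoly_linear (mxsub (lshift n) (widen_ord (psi_leq n_gt1))) P.
by exists Q => g; apply: QE.
Qed.

Lemma pullback_BSp (f : BGL C n) :
  (val f \o psi n_gt1 : fct (Sp C n) C) \in BSp_pred (n := n).
Proof.
have /asboolP[[P fP] fi] := valP f; apply/asboolP; split.
  by have [Q QE] := psi_regular P; exists Q => g; rewrite /= fP QE.
move=> ubar u g; rewrite !unfold_in => /= ul /andP[up uu].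
rewrite /= psi_triangular //; last 2 first.
- by case/andP: ul.
- by case/andP: uu.
by apply: fi; [apply: ulsubmx_lower_unip | apply: Sp_pred_block_upper_unip].
Qed.

Definition psi_star (f : BGL C n) : BSp C n :=
  exist (fun k => k \in BSp_pred (n := n)) _ (pullback_BSp f).

Lemma psi_starE f g : val (psi_star f) g = val f (psi n_gt1 g).
Proof. by []. Qed.

Fact psi_star_linear : linear psi_star.
Proof. by move=> a f g; apply: val_inj; apply/funext => x. Qed.

Fact psi_star_multiplicative : monoid_morphism psi_star.
Proof. by split=> [|f g]; apply: val_inj; apply/funext. Qed.

HB.instance Definition _ :=
  GRing.isLinear.Build C (BGL C n) (BSp C n) *:%R psi_star psi_star_linear.
HB.instance Definition _ :=
  GRing.isMonoidMorphism.Build (BGL C n) (BSp C n) psi_star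
    psi_star_multiplicative.

Lemma psi_star_SL2 h f : psi_star (BGL_SL2 h f) = BSp_SL2 h (psi_star f).
Proof. by apply: val_inj; apply/funext => g; rewrite /= psi_SL2. Qed.

(** The image of psi contains all matrices with invertible frame. *)
Lemma psi_dominant (P Q : {mpoly C[n * n.+1]}) :
  (forall g, ev (psi n_gt1 g) P = ev (psi n_gt1 g) Q) -> P = Q.
Proof.
by move=> PQ; apply: frame_dense => x xU; rewrite -(psi_cell_section n_gt1 xU).
Qed.

Lemma psi_star_inj : injective psi_star.
Proof.
move=> f f' ff'; apply: val_inj; apply/funext => x.
have /asboolP[[P fP] _] := valP f; have /asboolP[[P' fP'] _] := valP f'.
rewrite fP fP'; congr (meval _ _); apply: psi_dominant => g.
by rewrite -fP -fP' -!psi_starE ff'.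
Qed.

Lemma mpoly_mulmx (a : 'M[C]_n) (b : 'M[C]_n.+1) (P : {mpoly C[n * n.+1]}) :
  exists Q : {mpoly C[n * n.+1]}, forall x, ev (a *m x *m b) P = ev x Q.
Proof. exact: (mpoly_linear (mulmxr b \o mulmx a)). Qed.

(** Both sides are polynomials in x, so it suffices to compare them on the image
    of psi, where multiplication by a and b lifts to Sp_2n. *)
Lemma quasi_invariance_descends (P : {mpoly C[n * n.+1]}) (a : 'M[C]_n)
    (b : 'M[C]_n.-1) (c : C) :
  a \in unitmx -> b \in unitmx -> is_trig_mx b^T ->
  (forall g, ev (psi n_gt1 (levi a * g * levi_pred b)%g) P =
             c * ev (psi n_gt1 g) P) ->
  forall x, ev (a *m x *m diag_block n.+1 0 b) P = c * ev x P.
Proof.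
move=> aU bU bt H x; have [Q QE] := mpoly_mulmx a (diag_block n.+1 0 b) P.
rewrite QE -mevalZ; congr (meval _ _); apply: psi_dominant => g.
by rewrite mevalZ -H -QE psi_levi_pred // psi_levi.
Qed.

Lemma psi_star_surj (f : BSp C n) : exists F, psi_star F = f.
Proof.
have [P PE] := BSp_extension n_gt1 f; have /asboolP[_ fi] := valP f.
pose F : fct (Mat C n) C := fun x => ev x P.
have FB : F \in BGL_pred (n := n).
  apply/asboolP; split; first by exists P.
  move=> ubar u x ul uu.
  have ulU := lower_unip_unit ul; have uuU := upper_unip_unit uu.
  (* Invariance is quasi-invariance with multiplier 1. *)
  rewrite -[RHS]mul1r; apply: quasi_invariance_descends => //.
    by case/andP: uu.
  move=> g; rewrite mul1r -!PE; apply: fi; rewrite unfold_in.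
    exact: levi_lower_unip.
  rewrite Sp_pred_levi //=; apply: levi_upper_unip.
    exact: diag_block_pred_unit.
  exact: diag_block_upper_unip.
exists (exist (fun k => k \in BGL_pred (n := n)) _ FB).
by apply: val_inj; apply/funext => g; rewrite psi_starE PE.
Qed.

Lemma psi_star_bij : bijective psi_star.
Proof.
have /choice [inv invK] := psi_star_surj.
by exists inv => // f; apply: psi_star_inj; rewrite invK.
Qed.

Lemma weightE (k : nat) (d d' : 'I_k -> C) l : d =1 d' -> weight d l = weight d' l.
Proof. by move=> dd'; apply: eq_bigr => i _; rewrite dd'. Qed.

Lemma psi_star_component mu lambda (f : BGL C n) :
  BSp_component mu lambda (psi_star f) <-> BGL_component mu lambda f.
Proof.
split=> H.
  have /asboolP[[P fP] _] := valP f.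
  move=> t u x tT uT; have /andP[_ tU] := tT; have /andP[_ uU] := uT.
  rewrite !fP; apply: quasi_invariance_descends => //.
    by move: uT => /andP[]; rewrite is_diag_mxEtrig => /andP[].
  move=> g; rewrite -!fP -!psi_starE H.
  - congr (_ * _ * _); apply: weightE => i.
      by rewrite val_levi // block_mxEul.
    by have /matrixP/(_ i i) := Sp_pred_block_levi n_gt1 uU; rewrite mxE.
  - by rewrite unfold_in; apply: levi_torus.
  - rewrite unfold_in Sp_pred_levi //=.
    by apply: levi_torus; apply: diag_block_torus.
move=> t u g; rewrite !unfold_in => /= tT /andP[up uT].
have := tT; rewrite /torus is_diag_mxEtrig => /andP[/andP[tl _] _].
have := uT; rewrite /torus is_diag_mxEtrig => /andP[/andP[_ uu] _].
rewrite /= psi_triangular // H; last 2 first.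
- exact: ulsubmx_torus.
- exact: Sp_pred_block_torus.
by congr (_ * _ * _); apply: weightE => i; rewrite !mxE.
Qed.

End PsiStar.

Local Open Scope classical_set_scope.

Theorem theorem3p1 (R : realType) (n : nat) (n_gt1 : (1 < n)%N) :
  exists psi_star : {lrmorphism BGL R[i] n -> BSp R[i] n},
    [/\ forall f : BGL R[i] n, sval (psi_star f) = sval f \o psi n_gt1,
        bijective psi_star,
        forall (h : SL2 R[i]) (f : BGL R[i] n),
          psi_star (BGL_SL2 h f) = BSp_SL2 h (psi_star f)
      & forall (mu : dominant n.-1) (lambda : dominant n),
          psi_star @` BGL_component mu lambda = BSp_component mu lambda].
Proof.
exists (psi_star n_gt1); split=> //.
- exact: psi_star_bij.
- exact: psi_star_SL2.
move=> mu lambda; apply/seteqP; split=> [_ [f fH <-]|f fH].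
  exact/psi_star_component.
have [F FE] := psi_star_surj n_gt1 f; exists F => //.
by apply/(psi_star_component n_gt1); rewrite FE.
Qed.
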